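(* Let $E\subset\mathbb{C}$ be a compact set with $\mathrm{cap}(E)>0$ whose Green function satisfies the H\''older condition: there are constants $C(E)>0$ and $0<s\le1$ such that $$g_E(z,\infty)\le C(E)\,(d_E(z))^s,\qquad z\in\Omega_E.$$ Suppose that $Z_n=\{z_{k,n}\}_{k=1}^n\subset E$, $n\ge2$, satisfy $$\hat I[\tau(Z_n)]-V_E\le C_1\,\frac{\log n}{n},\qquad n\ge2,$$ where $C_1>0$ is a constant independent of $Z_n$. Let $\Omega_n=\{z\in\Omega_E:\ g_E(z,\infty)>1/n\}$ and $P_n(z)=\prod_{k=1}^n(z-z_{k,n})$. Then there is a constant $C_2>0$, independent of $z$ and of $Z_n$ (and of $n$), such that $$\left|\frac1n\log|P_n(z)|+V_E-g_E(z,\infty)\right|\le C_2\,\frac{\log n}{\sqrt n},\qquad z\in\overline{\Omega}_n,\ n\ge2.$$ Furthermore, with the same constant $C_2$, $$\log\|P_n\|_E+nV_E\le C_2\sqrt n\,\log n+1,\qquad n\ge2,$$ and there is a constant $C_3>0$, independent of $Z_n$ (and of $n$), such that $$-C_3\,\frac{\log n}{\sqrt n}\le\hat I[\tau(Z_n)]-V_E,\qquad n\ge2.$$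
   Context: For a Borel measure $\mu$ with compact support in $\mathbb{C}$, its energy is $I[\mu]=\iint\log\frac{1}{|z-t|}\,d\mu(t)\,d\mu(z)$. For compact $E\subset\mathbb{C}$, let $\mathcal{M}(E)$ be the set of all Borel probability measures supported on $E$; Robin's constant is $V_E=\inf_{\mu\in\mathcal{M}(E)}I[\mu]$ and the capacity is $\mathrm{cap}(E)=e^{-V_E}$. If $\mathrm{cap}(E)>0$, the infimum is attained by a unique measure $\mu_E\in\mathcal{M}(E)$, the equilibrium measure of $E$. $\Omega_E$ is the unbounded connected component of $\overline{\mathbb{C}}\setminus E$, and $g_E(z,\infty)$ is the Green function of $\Omega_E$ with pole at $\infty$, extended to all of $\mathbb{C}$ by $g_E(z,\infty)=V_E-\int\log\frac{1}{|z-t|}\,d\mu_E(t)$, $z\in\mathbb{C}$. The distance to $E$ is $d_E(z)=\min_{t\in E}|z-t|$ (the H\''older condition concerns finite points $z\in\Omega_E$). For a set of $n\ge 2$ points $Z_n=\{z_{k,n}\}_{k=1}^n$ (points listed with possible repetition), $\tau(Z_n)=\frac1n\sum_{k=1}^n\delta_{z_{k,n}}$ is the counting measure and the discrete energy is $$\hat I[\tau(Z_n)]=\frac{2}{n(n-1)}\sum_{1\le j<k\le n}\log\frac{1}{|z_{j,n}-z_{k,n}|}$$ ($+\infty$ if the points are not distinct). $\|P\|_E=\sup_{z\in E}|P(z)|$. The function $\frac1n\log|P_n(z)|+V_E-g_E(z,\infty)$ is given its limiting value $0$ at $z=\infty$. The constants $C_2,C_3$ may depend on $E$ (including $C(E)$,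 $s$) and on $C_1$. *)

(* Defs.v *)
From HB Require Import structures.
From mathcomp Require Import all_boot all_order all_algebra.
From mathcomp Require Import all_classical all_reals all_analysis.
From mathcomp Require Import complex.

Set Implicit Arguments.
Unset Strict Implicit.
Unset Printing Implicit Defensive.

Import Order.TTheory GRing.Theory Num.Theory.
Import numFieldNormedType.Exports.

Local Open Scope classical_set_scope.
Local Open Scope ring_scope.

(* The topology of a numFieldType is attached to the structure, not to the
   carrier [R[i]]: without this packing, [open], [compact], ... do not infer
   it. *)
Definition Cplx (R : realType) : numClosedFieldType := R[i]%C.

(* The Riemann sphere; [None] is the point at infinity. *)
Definition Sphere (R : realType) : topologicalType :=
  one_point_compactification (Cplx R).

Definition BorelC (R : realType) : measurableType (@open (Cplx R)).-sigma :=
  g_sigma_algebraType (@open (Cplx R)).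

(* Modulus with values in [R]; the norm of the numFieldType has values in the
   complex field itself. *)
Definition modulus (R : realType) (z : Cplx R) : R :=
  @ComplexField.Normc.normc R z.

(* log (1 / |z - t|), which is +oo for z = t since lne 0 = -oo *)
Definition log_kernel (R : realType) (z t : Cplx R) : \bar R :=
  (- lne (modulus (z - t))%:E)%E.

Definition potential (R : realType) (mu : probability (BorelC R) R)
    (z : Cplx R) : \bar R :=
  (\int[mu]_t log_kernel z t)%E.

Definition energy (R : realType) (mu : probability (BorelC R) R) : \bar R :=
  (\int[mu]_z potential mu z)%E.

(* For closed E, the support of mu is contained in E iff mu (~` E) = 0. *)
Definition supported_on (R : realType) (E : set (Cplx R))
    (mu : probability (BorelC R) R) : Prop :=
  (mu (~` E) = 0)%E.

(* V_E; it is +oo exactly when the capacity is 0. *)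
Definition robin (R : realType) (E : set (Cplx R)) : \bar R :=
  ereal_inf [set energy mu | mu in supported_on E].

Definition capacity (R : realType) (E : set (Cplx R)) : \bar R :=
  expeR (- robin E)%E.

Definition equilibrium_measure (R : realType) (E : set (Cplx R))
    (mu : probability (BorelC R) R) : Prop :=
  supported_on E mu /\ energy mu = robin E.

(* The component of the complement of E that contains the point at infinity *)
Definition Omega (R : realType) (E : set (Cplx R)) : set (Sphere R) :=
  connected_component (~` [set Some z | z in E] : set (Sphere R)) None.

(* g_E(., oo), where mu is the equilibrium measure of E *)
Definition green (R : realType) (E : set (Cplx R))
    (mu : probability (BorelC R) R) (x : Sphere R) : \bar R :=
  match x with
  | Some z => robin E - potential mu z
  | None => +oo
  end%E.

Definition dist (R : realType) (E : set (Cplx R)) (z : Cplx R) : R :=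
  inf [set modulus (z - t) | t in E].

Definition holder_green (R : realType) (E : set (Cplx R))
    (mu : probability (BorelC R) R) (CE s : R) : Prop :=
  forall z : Cplx R, Omega E (Some z) ->
    (green E mu (Some z) <= (CE * dist E z `^ s)%:E)%E.

Definition Omega_n (R : realType) (E : set (Cplx R))
    (mu : probability (BorelC R) R) (n : nat) : set (Sphere R) :=
  [set x | Omega E x /\ ((n%:R^-1)%:E < green E mu x)%E].

Definition discrete_energy (R : realType) (n : nat) (Z : 'I_n -> Cplx R) :
    \bar R :=
  ((2 / (n%:R * (n%:R - 1)))%:E *
   \sum_(j < n) \sum_(k < n | (j < k)%N) log_kernel (Z j) (Z k))%E.

Definition nodal_poly (R : realType) (n : nat) (Z : 'I_n -> Cplx R) :
    {poly Cplx R} :=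
  \prod_(k < n) ('X - (Z k)%:P).

Definition sup_norm (R : realType) (E : set (Cplx R)) (p : {poly Cplx R}) : R :=
  sup [set modulus p.[z] | z in E].

(* (1/n) log |P_n| + V_E - g_E(., oo), with its limiting value 0 at infinity *)
Definition log_deviation (R : realType) (E : set (Cplx R))
    (mu : probability (BorelC R) R) (n : nat) (Z : 'I_n -> Cplx R)
    (x : Sphere R) : \bar R :=
  match x with
  | Some z =>
      (n%:R^-1)%:E * lne (modulus (nodal_poly Z).[z])%:E + robin E
      - green E mu (Some z)
  | None => 0
  end%E.

(* Main.v *)
(**
Write [sigma = tau(Z_n) - mu] and replace the kernel [log (1/|u - v|)] by
[- 1/2 ln ((1 - e) |u - v|^2 + e (1 + |u|^2) (1 + |v|^2))].  Up to functions of
[u] and of [v] alone this is [- 1/2 ln (1 - (1 - e) k)], where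
[k = |1 + u v^*|^2 / ((1 + |u|^2) (1 + |v|^2))] is a finite sum of
products [f u * f v] of bounded functions on the Riemann sphere; expanding the
logarithm in powers of [k] shows that it is positive definite, also with point
masses, at infinity as well.  The energy of [sigma] for this kernel is at most
[O(log n / n)] when [e] is a power of [1/n]: the discrete part is controlled by
the hypothesis on the discrete energy, the part of [mu] by [V_E], and the mixed
part by the bound [U(z) >= V_E - O(1/n)] on [E] for the regularized potential
[U] of [mu].  Cauchy-Schwarz against a point mass at [z], whose energy is
[O(log n)], gives the deviation [O(log n / sqrt n)].

The bound on [U] comes from a maximum principle for
[z |-> int ln (|z - t|^2 + d^2) dmu(t)]: already its mean over the four points
[z + d i^k] exceeds its value at [z], so its supremum near the hull of [E] is
controlled by its values at points of [Omega E] at distance comparable to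
[n^(-1/s)] from [E], where the Hoelder condition applies.
*)
Require Import Defs.
From HB Require Import structures.
From mathcomp Require Import all_boot all_order all_algebra.
From mathcomp Require Import all_classical all_reals all_analysis.
From mathcomp Require Import complex.
From mathcomp Require Import measurable_realfun ring lra.

Set Implicit Arguments.
Unset Strict Implicit.
Unset Printing Implicit Defensive.

Import Order.TTheory GRing.Theory Num.Theory.
Import numFieldNormedType.Exports.

Local Open Scope classical_set_scope.
Local Open Scope ring_scope.

(** * Moduli and the topology of the sphere *)

Section Modulus.
Variable R : realType.
Implicit Types z w t : Cplx R.

Lemma modulus_sqr z : modulus z ^+ 2 = complex.Re z ^+ 2 + complex.Im z ^+ 2.
Proof.
by case: z => a b; rewrite /modulus /= sqr_sqrtr ?addr_ge0 ?sqr_ge0.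
Qed.

Lemma modulus_ge0 z : 0 <= modulus z.
Proof. by case: z => a b; exact: sqrtr_ge0. Qed.

Lemma modulusD z w : modulus (z + w) <= modulus z + modulus w.
Proof. exact: le_normcD. Qed.

Lemma modulusM z w : modulus (z * w) = modulus z * modulus w.
Proof. exact: ComplexField.Normc.normcM. Qed.

Lemma modulusN z : modulus (- z) = modulus z.
Proof. exact: normcN. Qed.

Lemma modulusC z w : modulus (z - w) = modulus (w - z).
Proof. by rewrite -modulusN opprB. Qed.

Lemma modulus0 : modulus (0 : Cplx R) = 0.
Proof. exact: ComplexField.Normc.normc0. Qed.

Lemma modulus1 : modulus (1 : Cplx R) = 1.
Proof. exact: ComplexField.Normc.normc1. Qed.

Lemma modulus_tri t z w : modulus (z - w) <= modulus (z - t) + modulus (t - w).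
Proof. by have := modulusD (z - t) (t - w); rewrite addrA subrK. Qed.

Lemma modulus_real (a : R) : modulus ((a%:C)%C : Cplx R) = `|a|.
Proof. by rewrite /modulus /= expr0n addr0 sqrtr_sqr. Qed.

Lemma modulus_prod (I : finType) (f : I -> Cplx R) :
  modulus (\prod_i f i) = \prod_i modulus (f i).
Proof.
by apply: (big_morph (@modulus R)); [exact: modulusM|exact: modulus1].
Qed.

Lemma normCE z : `|z| = ((modulus z)%:C)%C.
Proof. by []. Qed.

Lemma normC_lt z (e : R) : (`|z| < (e%:C)%C :> Cplx R) = (modulus z < e).
Proof. by rewrite normCE; exact: ltcR. Qed.

Lemma gt0_complex (e : Cplx R) : 0 < e -> exists2 a : R, 0 < a & e = (a%:C)%C.
Proof.
case: e => a b; rewrite ltcE /= => /andP[/eqP -> a0]; exists a => //.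
Qed.

Lemma nbhs_modulusP z (U : set (Cplx R)) :
  nbhs z U <-> exists2 a : R, 0 < a & forall w, modulus (z - w) < a -> U w.
Proof.
split => [/nbhs_ballP[e /= e0 zU]|[a a0 zU]].
  have [a a0 ea] := gt0_complex e0; exists a => // w zw; apply: zU.
  by rewrite -ball_normE /ball_ /= ea normC_lt.
apply/nbhs_ballP; exists (a%:C)%C; first by rewrite /= ltcR.
by move=> w; rewrite -ball_normE /ball_ /= normC_lt; exact: zU.
Qed.

End Modulus.

Section Topology.
Variable R : realType.
Implicit Types (z w : Cplx R) (E : set (Cplx R)).

Lemma lipschitz1_continuous (f : Cplx R -> R) :
  (forall z w, `|f z - f w| <= modulus (z - w)) -> continuous f.
Proof.
move=> fL z U /nbhs_ballP[e /= e0 eU]; apply/nbhs_modulusP; exists e => // w zw.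
by apply: eU; exact: le_lt_trans (fL z w) zw.
Qed.

Lemma Re_le_modulus z : `|complex.Re z| <= modulus z.
Proof.
by rewrite -ler_sqr ?nnegrE ?modulus_ge0 // real_normK ?num_real // modulus_sqr lerDl sqr_ge0.
Qed.

Lemma Im_le_modulus z : `|complex.Im z| <= modulus z.
Proof.
by rewrite -ler_sqr ?nnegrE ?modulus_ge0 // real_normK ?num_real // modulus_sqr lerDr sqr_ge0.
Qed.

Lemma continuous_Re : continuous (@complex.Re R : Cplx R -> R).
Proof.
apply: lipschitz1_continuous => z w; apply: le_trans (Re_le_modulus _).
by case: z w => [a b] [c d].
Qed.

Lemma continuous_Im : continuous (@complex.Im R : Cplx R -> R).
Proof.
apply: lipschitz1_continuous => z w; apply: le_trans (Im_le_modulus _).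
by case: z w => [a b] [c d].
Qed.

Lemma continuous_modulus : continuous (@modulus R).
Proof.
apply: lipschitz1_continuous => z w.
have := modulusD (z - w) w; have := modulusD (w - z) z.
by rewrite !subrK modulusC ler_norml; lra.
Qed.

Lemma compact_modulus_bounded E : compact E ->
  exists2 rho : R, 1 <= rho & forall z, E z -> modulus z <= rho.
Proof.
move=> cE; have /compact_bounded[M [_ ME]] : compact (@modulus R @` E).
  by apply: continuous_compact cE; apply: continuous_subspaceT; exact: continuous_modulus.
exists (Num.max 1 (M + 1)); first by rewrite le_max lexx.
move=> z Ez; rewrite -[modulus z]ger0_norm ?modulus_ge0 //.
by apply: ME; [rewrite lt_max; apply/orP; right; lra|exists z].
Qed.

Lemma compact_closedC E : compact E -> closed E.
Proof. by apply: compact_closed; exact: norm_hausdorff. Qed.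

Lemma continuous_line z w : continuous (fun t : R => z + (t%:C)%C * w : Cplx R).
Proof.
move=> t U /nbhs_modulusP[a a0 aU]; apply/nbhs_ballP.
exists (a / (modulus w + 1)) => /=.
  by rewrite divr_gt0 // ltr_wpDl ?modulus_ge0.
move=> u; rewrite /ball /= => tu; apply: aU.
rewrite opprD addrACA subrr add0r -mulrBl -rmorphB modulusM modulus_real.
have w1 : 0 < modulus w + 1 by rewrite ltr_wpDl ?modulus_ge0.
apply: (@le_lt_trans _ _ (`|t - u| * (modulus w + 1))).
  by rewrite ler_wpM2l ?normr_ge0 // lerDl.
by rewrite -ltr_pdivlMr.
Qed.

Lemma Omega_trans_line E z w (A : set R) (t u : R) :
  is_interval A -> A t -> A u ->
  (forall v, A v -> ~ E (z + (v%:C)%C * w)) ->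
  Omega E (Some (z + (t%:C)%C * w)) -> Omega E (Some (z + (u%:C)%C * w)).
Proof.
move=> iA At Au AE Ot; apply: connected_component_trans Ot _.
exists (Some @` ((fun v : R => z + (v%:C)%C * w) @` A) : set (Sphere R)).
  split.
  - by exists (z + (t%:C)%C * w) => //; exists t.
  - by move=> _ [_ [v Av <-] <-] /= [x Ex [xE]]; apply: (AE v); rewrite // -xE.
  - apply: connected_continuous_connected; last first.
      by apply: continuous_subspaceT; exact: one_point_compactification_some_continuous.
    apply: connected_continuous_connected; first exact/connected_intervalP.
    by apply: continuous_subspaceT; exact: continuous_line.
by exists (z + (u%:C)%C * w) => //; exists u.
Qed.

Lemma Omega_segment E z w :
  (forall x, modulus (x - z) <= modulus (w - z) -> ~ E x) ->
  Omega E (Some z) -> Omega E (Some w).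
Proof.
move=> nE.
have {1}-> : z = z + (0%:C)%C * (w - z) by rewrite mul0r addr0.
have {2}-> : w = z + (1%:C)%C * (w - z) by rewrite mul1r addrC subrK.
apply: (@Omega_trans_line _ _ _ `[0, 1]).
- exact: interval_is_interval.
- by rewrite /= in_itv /= lexx ler01.
- by rewrite /= in_itv /= lexx ler01.
- move=> v /=; rewrite in_itv /= => /andP[v0 v1]; apply: nE.
  by rewrite addrC addKr modulusM modulus_real ger0_norm // ler_piMl ?modulus_ge0.
Qed.

Lemma Omega_far E rho z : (forall x, E x -> modulus x <= rho) ->
  0 <= rho -> rho < modulus z -> Omega E (Some z).
Proof.
move=> Erho rho0 zrho.
pose ray := Some @` ((fun v : R => 0 + (v%:C)%C * z : Cplx R) @` `[1, +oo[) : set (Sphere R).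
have cray : connected ray.
  apply: connected_continuous_connected; last first.
    by apply: continuous_subspaceT; exact: one_point_compactification_some_continuous.
  apply: connected_continuous_connected.
    by apply/connected_intervalP; exact: interval_is_interval.
  by apply: continuous_subspaceT; exact: continuous_line.
have z0 : 0 < modulus z by exact: le_lt_trans zrho.
have None_ray : closure ray None.
  move=> U [C [cC _] CU]; have [M M1 CM] := compact_modulus_bounded cC.
  pose v := Num.max 1 ((M + 1) / modulus z).
  have vz : M < v * modulus z.
    apply: (@lt_le_trans _ _ (((M + 1) / modulus z) * modulus z)).
      by rewrite divfK ?gt_eqF // ltrDl.
    by rewrite ler_wpM2r ?modulus_ge0 // le_max lexx orbT.
  exists (Some (0 + (v%:C)%C * z)); split.
    exists (0 + (v%:C)%C * z) => //; exists v => //=.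
    by rewrite in_itv /= andbT le_max lexx.
  apply: CU; left; exists (0 + (v%:C)%C * z) => // /CM.
  rewrite add0r modulusM modulus_real ger0_norm; first by rewrite leNgt vz.
  by rewrite le_max ler01.
apply: connected_component_sym.
exists (closure ray) => //; split; last exact: connected_closure.
  by apply: subset_closure; exists z => //; exists 1; rewrite ?mul1r ?add0r //= in_itv /= lexx.
move=> x0 + [x Ex xy]; rewrite -{x0}xy => rx.
have /rx[_ [[_ [v + <-] <-] [y + [yE]]]] :
    nbhs (Some x : Sphere R) (Some @` [set y | modulus (x - y) < modulus z - rho]).
  apply: one_point_compactification_some_nbhs; apply/nbhs_modulusP.
  by exists (modulus z - rho) => //; rewrite subr_gt0.
rewrite yE /= in_itv /= andbT => v1; apply/negP; rewrite -leNgt.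
have := modulus_tri x (0 + (v%:C)%C * z) 0; rewrite !subr0 add0r modulusC.
rewrite [modulus (_ * _)]modulusM modulus_real ger0_norm; last by lra.
have : modulus z <= v * modulus z by rewrite ler_peMl ?modulus_ge0.
by have := Erho _ Ex; lra.
Qed.

Lemma closure_Some (A : set (Sphere R)) z a : 0 < a ->
  closure A (Some z) -> exists2 w, A (Some w) & modulus (z - w) < a.
Proof.
move=> a0 Az; have /Az[y [Ay [w zw wy]]] :
    nbhs (Some z : Sphere R) (Some @` [set y | modulus (z - y) < a]).
  by apply: one_point_compactification_some_nbhs; apply/nbhs_modulusP; exists a.
by exists w; rewrite ?wy.
Qed.

End Topology.

(** * Averages over the equilibrium measure *)

Section IntegralMonotone.
Local Open Scope ereal_scope.

(* The integral is a difference of two suprema of integrals of simple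
   functions, so it is monotone even on non-measurable functions. *)
Lemma le_integral_nomeas d (T : measurableType d) (R : realType)
    (m : {measure set T -> \bar R}) (f g : T -> \bar R) :
  (forall x, f x <= g x) -> \int[m]_x f x <= \int[m]_x g x.
Proof.
move=> fg; rewrite /integral !patch_setT; apply: leeB; apply: le_ereal_sup.
- move=> _ [h /= hf <-]; exists h => //= x; apply: le_trans (hf x) _.
  by rewrite !funeposE ge_max !le_max fg lexx orbT.
- move=> _ [h /= hf <-]; exists h => //= x; apply: le_trans (hf x) _.
  by rewrite !funenegE ge_max !le_max leeN2 fg lexx orbT.
Qed.

End IntegralMonotone.

Section Average.
Variables (R : realType) (E : set (Cplx R)) (mu : probability (BorelC R) R).
Hypotheses (cE : compact E) (muE : supported_on E mu).

Definition avg (f : Cplx R -> R) : R := Rintegral mu (E : set (BorelC R)) f.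

Definition admissible (f : Cplx R -> R) : Prop :=
  measurable_fun setT (f : BorelC R -> R) /\
  exists M, forall t, E t -> `|f t| <= M.

Lemma measurable_open_BorelC (U : set (Cplx R)) :
  open U -> measurable (U : set (BorelC R)).
Proof. by move=> oU; exact: sub_sigma_algebra. Qed.

Lemma measurable_support : measurable (E : set (BorelC R)).
Proof.
rewrite -(setCK E); apply: measurableC; apply: measurable_open_BorelC.
by rewrite openC; exact: compact_closedC.
Qed.

Lemma mu_support : mu (E : set (BorelC R)) = 1%E.
Proof.
have := probability_setC mu (measurableC measurable_support).
by rewrite setCK muE sube0.
Qed.

Lemma continuous_measurable_BorelC (f : Cplx R -> R) :
  continuous f -> measurable_fun setT (f : BorelC R -> R).
Proof.
move=> /continuousP cf; apply: (measurability _ (RGenOpens.measurableE R)).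
move=> _ [_ [a [b ->] <-]]; rewrite setTI.
by apply: measurable_open_BorelC; exact/cf/interval_open.
Qed.

Lemma admissible_integrable f : admissible f ->
  mu.-integrable (E : set (BorelC R)) (EFin \o f).
Proof.
move=> [mf [M fM]]; apply: measurable_bounded_integrable.
- exact: measurable_support.
- by rewrite [X in (X < _)%E]mu_support ltry.
- exact: measurable_funTS.
- exists M; split; first exact: num_real.
  by move=> x Mx t Et; apply: le_trans (fM t Et) _; exact: ltW.
Qed.

Lemma avgE f : admissible f ->
  ((avg f)%:E = \int[mu]_(t in (E : set (BorelC R))) (f t)%:E)%E.
Proof.
move=> af; rewrite /avg /Rintegral fineK //.
by apply: integrable_fin_num; [exact: measurable_support|exact: admissible_integrable].
Qed.

Lemma avg_cst c : avg (fun=> c) = c.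
Proof.
rewrite /avg Rintegral_cst; last exact: measurable_support.
by rewrite [X in fine X]mu_support /= mulr1.
Qed.

Lemma avgD f g : admissible f -> admissible g ->
  avg (fun t => f t + g t) = avg f + avg g.
Proof.
move=> af ag; apply: RintegralD; [exact: measurable_support| |];
  exact: admissible_integrable.
Qed.

Lemma avgZ c f : admissible f -> avg (fun t => c * f t) = c * avg f.
Proof.
move=> af; apply: RintegralZl; [exact: measurable_support|].
exact: admissible_integrable.
Qed.

Lemma avg_le f g : admissible f -> admissible g ->
  (forall t, E t -> f t <= g t) -> avg f <= avg g.
Proof.
move=> af ag fg; rewrite /avg.
exact: (le_Rintegral measurable_support (admissible_integrable af) (admissible_integrable ag) fg).
Qed.

Lemma eq_avg f g : (forall t, E t -> f t = g t) -> avg f = avg g.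
Proof. by move=> fg; apply: eq_Rintegral => t /set_mem; exact: fg. Qed.

Lemma admissible_cst c : admissible (fun=> c).
Proof. by split; [exact: measurable_cst|exists `|c|]. Qed.

Lemma admissibleD f g : admissible f -> admissible g ->
  admissible (fun t => f t + g t).
Proof.
move=> [mf [M fM]] [mg [N gN]]; split; first exact: measurable_funD.
exists (M + N) => t Et; apply: le_trans (ler_normD _ _) _.
by rewrite lerD ?fM ?gN.
Qed.

Lemma admissibleM f g : admissible f -> admissible g ->
  admissible (fun t => f t * g t).
Proof.
move=> [mf [M fM]] [mg [N gN]]; split; first exact: measurable_funM.
exists (M * N) => t Et; rewrite normrM.
by apply: ler_pM; rewrite ?normr_ge0 ?fM ?gN.
Qed.

Lemma admissibleZ c f : admissible f -> admissible (fun t => c * f t).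
Proof. by apply: admissibleM; exact: admissible_cst. Qed.

Lemma admissibleN f : admissible f -> admissible (fun t => - f t).
Proof.
move=> [mf [M fM]]; split; first exact: measurableT_comp.
by exists M => t Et; rewrite normrN fM.
Qed.

Lemma avgN f : admissible f -> avg (fun t => - f t) = - avg f.
Proof.
move=> af; rewrite -mulN1r -avgZ //.
by apply: eq_avg => t _; rewrite mulN1r.
Qed.

Lemma admissible_sum (I : Type) (s : seq I) (f : I -> Cplx R -> R) :
  (forall i, admissible (f i)) -> admissible (fun t => \sum_(i <- s) f i t).
Proof.
move=> af; elim: s => [|i s IH].
  by under eq_fun do rewrite big_nil; exact: admissible_cst.
by under eq_fun do rewrite big_cons; exact: admissibleD.
Qed.

Lemma avg_sum (I : Type) (s : seq I) (f : I -> Cplx R -> R) :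
  (forall i, admissible (f i)) ->
  avg (fun t => \sum_(i <- s) f i t) = \sum_(i <- s) avg (f i).
Proof.
move=> af; elim: s => [|i s IH].
  by rewrite big_nil; under eq_fun do rewrite big_nil; exact: avg_cst.
rewrite big_cons -IH -avgD //; last exact: admissible_sum.
by congr avg; apply/funext => t; rewrite big_cons.
Qed.

Lemma avg_norm_le f M : admissible f -> (forall t, E t -> `|f t| <= M) ->
  `|avg f| <= M.
Proof.
move=> af fM; rewrite ler_norml -{1}(avg_cst (- M)) -{2}(avg_cst M).
by apply/andP; split; apply: avg_le => //; try exact: admissible_cst;
  move=> t /fM; rewrite ler_norml => /andP[].
Qed.

Lemma integral_support_eq (f : Cplx R -> R) (c : \bar R) : admissible f ->
  (\int[mu]_t (if t \in E then (f t)%:E else c) = (avg f)%:E)%E.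
Proof.
move=> af; rewrite avgE // [RHS]integral_mkcond.
have mE : measurable_fun setT (fun t : BorelC R => t \in E).
  by apply: (@measurable_fun_bool _ _ _ _ true); rewrite setTI preimage_mem_true;
    exact: measurable_support.
have mf : measurable_fun setT (fun t : BorelC R => (f t)%:E).
  by apply/measurable_EFinP; case: af.
apply: ae_eq_integral => //.
- exact: measurable_fun_ifT.
- exact: measurable_fun_ifT.
- exists (~` E); split.
  + by apply: measurableC; exact: measurable_support.
  + exact: muE.
  + move=> t /= + Et; apply => _; rewrite patchE.
    by rewrite (mem_set Et).
Qed.

Lemma integral_ge_avg (f : Cplx R -> R) (g : Cplx R -> \bar R) :
  admissible f -> (forall t, E t -> ((f t)%:E <= g t)%E) ->
  ((avg f)%:E <= \int[mu]_t g t)%E.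
Proof.
move=> af fg; rewrite -(integral_support_eq -oo%E af).
apply: le_integral_nomeas => t; case: ifPn => [/set_mem|_]; first exact: fg.
exact: leNye.
Qed.

Lemma integral_le_avg (f : Cplx R -> R) (g : Cplx R -> \bar R) :
  admissible f -> (forall t, E t -> (g t <= (f t)%:E)%E) ->
  (\int[mu]_t g t <= (avg f)%:E)%E.
Proof.
move=> af fg; rewrite -(integral_support_eq +oo%E af).
apply: le_integral_nomeas => t; case: ifPn => [/set_mem|_]; first exact: fg.
exact: leey.
Qed.

Lemma support_nonempty : exists t, E t.
Proof.
apply/not_existsP => nE; have E0 : E = set0 by rewrite -subset0 => t /nE.
have := mu_support; rewrite E0 measure0 => /eqP.
by rewrite eq_sym onee_eq0.
Qed.

End Average.

(** * Positive definite kernels *)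

Section LogSeries.
Variable R : realType.

Lemma ln_series_is_derive M (x : R) : x < 1 ->
  is_derive x 1 (fun y : R => - ln (1 - y) - \sum_(m < M) m.+1%:R^-1 * y ^+ m.+1)
    (x ^+ M / (1 - x)).
Proof.
move=> x1; have x10 : 0 < 1 - x by rewrite subr_gt0.
have dln : is_derive x (1 : R) (fun y : R => - ln (1 - y)) (1 - x)^-1.
  have dB : is_derive x (1 : R) (fun y : R => 1 - y) (0 - 1).
    exact: is_deriveB.
  have := @is_derive1_comp _ _ (fun y : R => 1 - y) _ _ _ (is_derive1_ln x10) dB.
  by move=> /is_deriveN; rewrite sub0r mulrN1 opprK.
have dsum : is_derive x (1 : R) (fun y : R => \sum_(m < M) m.+1%:R^-1 * y ^+ m.+1)
    (\sum_(m < M) x ^+ m).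
  have := @is_derive_sum R R R M (fun m (y : R) => m.+1%:R^-1 * y ^+ m.+1) x 1 (fun m => x ^+ m).
  rewrite fct_sumE; apply => m.
  have -> : (fun y : R => m.+1%:R^-1 * y ^+ m.+1) = m.+1%:R^-1 \*: (id ^+ m.+1 : R -> R).
    by apply/funext => y; rewrite /= exprfctE.
  apply: is_derive_eq (is_deriveZ m.+1%:R^-1 (is_deriveX m.+1 (is_derive_id x (1 : R)))) _.
  by rewrite /GRing.scale /= mulr1 mulrA mulVf ?pnatr_eq0 // mul1r.
have -> : x ^+ M / (1 - x) = (1 - x)^-1 - \sum_(m < M) x ^+ m.
  apply: (mulIf (lt0r_neq0 x10)); rewrite divfK ?gt_eqF // mulrBl mulVf ?gt_eqF //.
  by have := subrX1 x M; set S := \sum_(i < M) _ => SE; lra.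
exact: is_deriveB.
Qed.

Lemma ln_series_bound M (c x : R) : 0 <= x -> x <= c -> c < 1 ->
  `|- ln (1 - x) - \sum_(m < M) m.+1%:R^-1 * x ^+ m.+1| <= c ^+ M / (1 - c).
Proof.
move=> x0 xc c1; set h := fun y : R => - ln (1 - y) - \sum_(m < M) m.+1%:R^-1 * y ^+ m.+1.
have c0 : 0 <= c by exact: le_trans xc.
have h0 : h 0 = 0.
  rewrite /h subr0 ln1 oppr0 sub0r big1 ?oppr0 // => m _.
  by rewrite expr0n mulr0.
have c10 : 0 < 1 - c by rewrite subr_gt0.
move: x0; rewrite le_eqVlt => /orP[/eqP <-|x0].
  by rewrite [X in `|X|]h0 normr0 divr_ge0 ?exprn_ge0 // ltW.
have x1 : x < 1 by exact: le_lt_trans c1.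
have [| |y] := @MVT _ h (fun y => y ^+ M / (1 - y)) 0 x x0.
- by move=> y; rewrite in_itv /= => /andP[_ yx]; apply: ln_series_is_derive; exact: lt_trans x1.
- apply: derivable_within_continuous => y; rewrite in_itv /= => /andP[_ yx].
  by have [] := ln_series_is_derive M (le_lt_trans yx x1).
rewrite in_itv /= => /andP[y0 yx]; rewrite h0 !subr0 => hx.
rewrite [X in `|X|]hx.
have y1 : 0 < 1 - y by rewrite subr_gt0 (lt_trans yx).
rewrite ger0_norm; last by rewrite mulr_ge0 ?divr_ge0 ?exprn_ge0 // ltW.
rewrite -[leRHS]mulr1; apply: ler_pM => //; last exact: ltW.
- by rewrite divr_ge0 ?exprn_ge0 // ltW.
- exact: ltW.
- apply: ler_pM; rewrite ?exprn_ge0 ?invr_ge0 //; try exact: ltW.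
    by rewrite lerXn2r ?nnegrE //; lra.
  by rewrite lef_pV2 ?posrE //; lra.
Qed.

Lemma expr_small (c e : R) : 0 <= c -> c < 1 -> 0 < e -> exists M, c ^+ M <= e.
Proof.
move=> c0 c1 e0.
have /cvgrPdist_le/(_ _ e0)[M _ /(_ M (leqnn M))] : c ^+ n @[n --> \oo] --> (0 : R).
  by apply: cvg_expr; rewrite ger0_norm.
by rewrite sub0r normrN ger0_norm ?exprn_ge0 // => ?; exists M.
Qed.

End LogSeries.

Section PositiveKernels.
Variables (R : realType) (T : Type) (B : (T -> R) -> Prop).
Hypothesis B_cst : forall c, B (fun=> c).
Hypothesis BD : forall f g, B f -> B g -> B (fun x => f x + g x).
Hypothesis BM : forall f g, B f -> B g -> B (fun x => f x * g x).

Definition finite_pd (q : T -> T -> R) : Prop :=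
  exists2 s : seq (T -> R), (forall i, B (nth (fun=> 0) s i)) &
    forall u v, q u v = \sum_(f <- s) f u * f v.

Definition bounded_functional (L : (T -> R) -> R) : Prop :=
  [/\ forall f g, B f -> B g -> L (fun x => f x + g x) = L f + L g,
      forall c f, B f -> L (fun x => c * f x) = c * L f &
      exists2 C : R, 0 <= C &
        forall f M, B f -> (forall x, `|f x| <= M) -> `|L f| <= C * M].

Let B0 : B (fun=> 0). Proof. exact: B_cst. Qed.

Lemma finite_pdD q1 q2 : finite_pd q1 -> finite_pd q2 ->
  finite_pd (fun u v => q1 u v + q2 u v).
Proof.
move=> [s1 B1 q1E] [s2 B2 q2E]; exists (s1 ++ s2).
  by move=> i; rewrite nth_cat; case: ifP.
by move=> u v; rewrite big_cat q1E q2E.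
Qed.

Lemma finite_pdM q1 q2 : finite_pd q1 -> finite_pd q2 ->
  finite_pd (fun u v => q1 u v * q2 u v).
Proof.
move=> [s1 B1 q1E] [s2 B2 q2E].
pose s := [seq (fun x => f x * g x) | f <- s1, g <- s2].
exists s.
  rewrite /s; elim: s1 B1 {q1E s} => [|f s1 IH] B1 i; first by rewrite /= nth_nil.
  rewrite allpairs_cons nth_cat; case: ifP => [lti|_]; last by apply: IH => j; exact: (B1 j.+1).
  rewrite size_map in lti; rewrite (nth_map (fun=> 0)) //.
  by apply: BM => //; exact: (B1 0%N).
move=> u v; rewrite q1E q2E big_allpairs_dep big_distrl /=; apply: eq_bigr => f _.
rewrite big_distrr /=; apply: eq_bigr => g _; ring.
Qed.

Lemma finite_pd_cst c : 0 <= c -> finite_pd (fun _ _ => c).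
Proof.
move=> c0; exists [:: fun=> Num.sqrt c].
  by move=> [|i] /=; rewrite ?nth_nil; exact: B_cst.
by move=> u v; rewrite big_seq1 -expr2 sqr_sqrtr.
Qed.

Lemma finite_pdX q m : finite_pd q -> finite_pd (fun u v => q u v ^+ m).
Proof.
move=> qpd; elim: m => [|m IH].
  by under eq_fun do under eq_fun do rewrite expr0; exact: finite_pd_cst.
by under eq_fun do under eq_fun do rewrite exprS; exact: finite_pdM.
Qed.

Lemma finite_pd_sum M (q : nat -> T -> T -> R) : (forall m, finite_pd (q m)) ->
  finite_pd (fun u v => \sum_(m < M) q m u v).
Proof.
move=> qpd; elim: M => [|M IH].
  by under eq_fun do under eq_fun do rewrite big_ord0; exact: finite_pd_cst.
by under eq_fun do under eq_fun do rewrite big_ord_recr /=; exact: finite_pdD.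
Qed.

Lemma functional_sum L (s : seq (T -> R)) (a : (T -> R) -> R) :
  bounded_functional L -> (forall i, B (nth (fun=> 0) s i)) ->
  B (fun x => \sum_(f <- s) a f * f x) /\
  L (fun x => \sum_(f <- s) a f * f x) = \sum_(f <- s) a f * L f.
Proof.
move=> [LD LZ _]; elim: s => [|f s IH] Bs.
  rewrite big_nil; under eq_fun do rewrite big_nil; split => //.
  by have := LZ 0 _ B0; rewrite !mul0r.
have [Bsum Lsum] := IH (fun i => Bs i.+1).
have Bf : B (fun x => a f * f x) by apply: BM => //; exact: (Bs 0%N).
rewrite big_cons -Lsum; under eq_fun do rewrite big_cons.
split; first exact: BD.
by rewrite LD // LZ //; exact: (Bs 0%N).
Qed.

Lemma finite_pd_ge0 L q : bounded_functional L -> finite_pd q ->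
  [/\ forall u, B (q u), B (fun u => L (q u)) & 0 <= L (fun u => L (q u))].
Proof.
move=> bL [s Bs qE].
have qu u : q u = fun v => \sum_(f <- s) f u * f v by apply/funext => v; rewrite qE.
have Lq : (fun u => L (q u)) = fun u => \sum_(f <- s) L f * f u.
  apply/funext => u; rewrite qu (functional_sum (fun f => f u) bL Bs).2.
  by apply: eq_bigr => f _; rewrite mulrC.
rewrite Lq; have [BL ->] := functional_sum L bL Bs; split=> //.
- by move=> u; rewrite qu; exact: (functional_sum (fun f => f u) bL Bs).1.
- by apply: sumr_ge0 => f _; rewrite -expr2 sqr_ge0.
Qed.

(* [- ln (1 - c k)] is the sum of the power series [\sum_m (c k) ^+ m / m],
   whose terms are positive definite. *)
Lemma ln_kernel_ge0 L k c : bounded_functional L -> finite_pd k ->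
  (forall u v, 0 <= k u v <= 1) -> 0 <= c -> c < 1 ->
  (forall u, B (fun v => - ln (1 - c * k u v))) ->
  B (fun u => L (fun v => - ln (1 - c * k u v))) ->
  0 <= L (fun u => L (fun v => - ln (1 - c * k u v))).
Proof.
move=> bL kpd k01 c0 c1 Bk BLk; set LL := L _.
have [LD LZ [C C0 LC]] := bL.
apply/ler_addgt0Pr => e e0.
have c10 : 0 < 1 - c by rewrite subr_gt0.
have C1 : 0 < C + 1 by rewrite ltr_wpDl.
have [M cM] := expr_small c0 c1 (divr_gt0 (mulr_gt0 e0 c10) (mulr_gt0 C1 C1)).
pose q u v := \sum_(m < M) m.+1%:R^-1 * (c * k u v) ^+ m.+1.
have qpd : finite_pd q.
  apply: (@finite_pd_sum M (fun m u v => m.+1%:R^-1 * (c * k u v) ^+ m.+1)) => m.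
  apply: finite_pdM.
    by apply: finite_pd_cst; rewrite invr_ge0.
  by apply: finite_pdX; apply: finite_pdM => //; exact: finite_pd_cst.
have [Bq BLq LLq] := finite_pd_ge0 bL qpd.
have BN f : B f -> B (fun x => - 1 * f x) by move=> Bf; exact: BM.
have LB f g : B f -> B g -> L (fun x => f x + - 1 * g x) = L f - L g.
  by move=> Bf Bg; rewrite LD // ?LZ ?mulN1r //; exact: BN.
pose d u v := - ln (1 - c * k u v) + - 1 * q u v.
have dle u v : `|d u v| <= c ^+ M / (1 - c).
  have /andP[k0 k1] := k01 u v; rewrite /d mulN1r.
  by apply: ln_series_bound => //; [rewrite mulr_ge0|rewrite ler_piMr].
have Bd u : B (d u) by apply: BD => //; exact: BN.
have Ld u : `|L (d u)| <= C * (c ^+ M / (1 - c)) by exact: LC.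
have LdE : L (fun u => L (d u)) = LL - L (fun u => L (q u)).
  have -> : (fun u => L (d u)) =
      fun u => L (fun v => - ln (1 - c * k u v)) + - 1 * L (q u).
    by apply/funext => u; rewrite LB // mulN1r.
  by rewrite LB.
have BLd : B (fun u => L (d u)).
  have -> : (fun u => L (d u)) =
      fun u => L (fun v => - ln (1 - c * k u v)) + - 1 * L (q u).
    by apply/funext => u; rewrite LB // mulN1r.
  by apply: BD => //; exact: BN.
have := LC _ _ BLd Ld; rewrite LdE ler_norml => /andP[+ _].
suff : C * (C * (c ^+ M / (1 - c))) <= e by lra.
move: cM; rewrite ler_pdivlMr ?mulr_gt0 // => cM.
rewrite !mulrA ler_pdivrMr //; apply: le_trans cM.
have := exprn_ge0 M c0; nra.
Qed.

End PositiveKernels.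

Section SphericalKernel.
Variable R : realType.
Implicit Types (z w : Cplx R) (u v : option (Cplx R)).

Definition phi z : R := 1 + modulus z ^+ 2.

Lemma phi_ge1 z : 1 <= phi z.
Proof. by rewrite /phi lerDl sqr_ge0. Qed.

Lemma phi_gt0 z : 0 < phi z.
Proof. exact: lt_le_trans (phi_ge1 z). Qed.

(* Feature maps of the stereographic projection; [None] is the north pole. *)
Definition features : seq (option (Cplx R) -> R) :=
  let re u := if u is Some z then complex.Re z / phi z else 0 in
  let im u := if u is Some z then complex.Im z / phi z else 0 in
  [:: fun u => if u is Some z then (phi z)^-1 else 0; re; re; im; im;
      fun u => if u is Some z then modulus z ^+ 2 / phi z else 1].

Definition sph u v : R := \sum_(f <- features) f u * f v.

Lemma sphE z w : phi z * phi w * sph (Some z) (Some w) =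
  phi z * phi w - modulus (z - w) ^+ 2.
Proof.
rewrite /sph /features !big_cons big_nil addr0 /= /phi.
have := phi_gt0 z; have := phi_gt0 w; rewrite /phi !modulus_sqr.
case: z w => [a b] [c d] /= p q.
by field; rewrite !gt_eqF.
Qed.

Lemma sphN z : phi z * sph None (Some z) = modulus z ^+ 2.
Proof.
rewrite /sph /features !big_cons big_nil /= !mul0r !add0r addr0 mul1r mulrC.
by rewrite divfK // gt_eqF // phi_gt0.
Qed.

Lemma sphNN : sph None None = 1.
Proof. by rewrite /sph /features !big_cons big_nil /= !mul0r !add0r addr0 mul1r. Qed.

Lemma sphC u v : sph u v = sph v u.
Proof. by apply: eq_bigr => f _; rewrite mulrC. Qed.

Lemma modulusB_le_phi z w : modulus (z - w) ^+ 2 <= phi z * phi w.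
Proof.
rewrite /phi !modulus_sqr; case: z w => [a b] [c d] /=.
have := sqr_ge0 (1 + a * c + b * d); have := sqr_ge0 (b * c - a * d); nra.
Qed.

Lemma sph_ge0_le1 u v : 0 <= sph u v <= 1.
Proof.
have N1 z : 0 <= sph None (Some z) <= 1.
  have p := phi_gt0 z; apply/andP; split.
    by rewrite -(pmulr_rge0 _ p) sphN sqr_ge0.
  by rewrite -(ler_pM2l p) sphN mulr1 /phi lerDr.
case: u v => [z|] [w|]; [|by rewrite sphC|by []|by rewrite sphNN ler01 lexx].
have p : 0 < phi z * phi w by rewrite mulr_gt0 ?phi_gt0.
apply/andP; split; first by rewrite -(pmulr_rge0 _ p) sphE subr_ge0 modulusB_le_phi.
by rewrite -(ler_pM2l p) sphE mulr1 gerBl sqr_ge0.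
Qed.

Lemma sph_diag u : sph u u = 1.
Proof.
case: u => [z|]; last exact: sphNN.
have p : 0 < phi z * phi z by rewrite mulr_gt0 ?phi_gt0.
apply: (mulfI (lt0r_neq0 p)).
by rewrite sphE subrr modulus0 expr0n subr0 mulr1.
Qed.

(* [kap e (Some z) (Some w)] is, up to a sum of functions of [z] and of [w],
   a regularization of [- 2 log |z - w|]; unlike the latter it is positive
   definite. *)
Definition kap (e : R) u v : R := - ln (1 - (1 - e) * sph u v).

Definition reg (e : R) z w : R :=
  (1 - e) * modulus (z - w) ^+ 2 + e * (phi z * phi w).

Section Regularized.
Variable e : R.
Hypotheses (e_gt0 : 0 < e) (e_lt1 : e < 1).

Let sph_in u v : e <= 1 - (1 - e) * sph u v <= 1.
Proof.
have /andP[s0 s1] := sph_ge0_le1 u v; have := e_lt1; have := e_gt0 => *.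
by apply/andP; split; nra.
Qed.

Lemma kapC u v : kap e u v = kap e v u.
Proof. by rewrite /kap sphC. Qed.

Lemma kap_ge0_le u v : 0 <= kap e u v <= - ln e.
Proof.
have /andP[h1 h2] := sph_in u v; rewrite oppr_ge0 ln_le0 //= lerN2.
by rewrite ler_ln ?posrE //; exact: lt_le_trans h1.
Qed.

Lemma kap_diag u : kap e u u = - ln e.
Proof. by rewrite /kap sph_diag mulr1 subKr. Qed.

Lemma reg_gt0 z w : 0 < reg e z w.
Proof.
apply: ltr_wpDl; last by rewrite !mulr_gt0 ?phi_gt0.
by rewrite mulr_ge0 ?sqr_ge0 // subr_ge0 ltW.
Qed.

Lemma kap_reg z w :
  kap e (Some z) (Some w) = ln (phi z) + ln (phi w) - ln (reg e z w).
Proof.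
have pz := phi_gt0 z; have pw := phi_gt0 w.
have -> : reg e z w = phi z * phi w * (1 - (1 - e) * sph (Some z) (Some w)).
  have := sphE z w; rewrite /reg; set s := sph _ _ => sE.
  by rewrite mulrBr mulr1 [_ * (_ * s)]mulrCA sE; ring.
have /andP[h1 _] := sph_in (Some z) (Some w).
rewrite !lnM ?posrE ?mulr_gt0 //; last exact: lt_le_trans h1.
by rewrite /kap; ring.
Qed.

Lemma kap_infty z : kap e None (Some z) = ln (phi z) - ln (1 + e * modulus z ^+ 2).
Proof.
have pz := phi_gt0 z.
have -> : 1 + e * modulus z ^+ 2 = phi z * (1 - (1 - e) * sph None (Some z)).
  by have := sphN z; set s := sph _ _ => sE; rewrite mulrBr mulr1 [_ * (_ * s)]mulrCA sE /phi; ring.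
have /andP[h1 _] := sph_in None (Some z).
rewrite lnM ?posrE //; last exact: lt_le_trans h1.
by rewrite /kap; ring.
Qed.

Lemma reg_ge z w : modulus (z - w) ^+ 2 <= reg e z w.
Proof. by have := ler_wpM2l (ltW e_gt0) (modulusB_le_phi z w); rewrite /reg; lra. Qed.

Lemma reg_diag z : e <= reg e z z.
Proof.
rewrite /reg subrr modulus0 expr0n mulr0 add0r.
by rewrite ler_peMr ?(ltW e_gt0) // -[leLHS]mulr1 ler_pM ?phi_ge1.
Qed.

End Regularized.

End SphericalKernel.

Section EnergyForm.
Variables (R : realType) (E : set (Cplx R)) (mu : probability (BorelC R) R).
Hypotheses (cE : compact E) (muE : supported_on E mu).
Variable e : R.
Hypotheses (e_gt0 : 0 < e) (e_lt1 : e < 1).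

Definition bounded_borel (f : option (Cplx R) -> R) : Prop :=
  measurable_fun setT (f \o Some : BorelC R -> R) /\
  exists M, forall x, `|f x| <= M.

Lemma bounded_borel_cst c : bounded_borel (fun=> c).
Proof. by split; [exact: measurable_cst|exists `|c|]. Qed.

Lemma bounded_borelD f g : bounded_borel f -> bounded_borel g ->
  bounded_borel (fun x => f x + g x).
Proof.
move=> [mf [M fM]] [mg [N gN]]; split; first exact: measurable_funD.
by exists (M + N) => x; apply: le_trans (ler_normD _ _) _; rewrite lerD.
Qed.

Lemma bounded_borelM f g : bounded_borel f -> bounded_borel g ->
  bounded_borel (fun x => f x * g x).
Proof.
move=> [mf [M fM]] [mg [N gN]]; split; first exact: measurable_funM.
by exists (M * N) => x; rewrite normrM; apply: ler_pM.
Qed.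

Lemma bounded_borel_admissible f : bounded_borel f -> admissible E (f \o Some).
Proof. by move=> [mf [M fM]]; split => //; exists M => t _; exact: fM. Qed.

Lemma measurable_Re : measurable_fun setT (@complex.Re R : BorelC R -> R).
Proof. by apply: continuous_measurable_BorelC; exact: continuous_Re. Qed.

Lemma measurable_Im : measurable_fun setT (@complex.Im R : BorelC R -> R).
Proof. by apply: continuous_measurable_BorelC; exact: continuous_Im. Qed.

Lemma measurable_modulus : measurable_fun setT (@modulus R : BorelC R -> R).
Proof. by apply: continuous_measurable_BorelC; exact: continuous_modulus. Qed.

Lemma measurable_phi : measurable_fun setT (@phi R : BorelC R -> R).
Proof.
apply: measurable_funD => //; apply: measurable_funX; exact: measurable_modulus.
Qed.

Lemma bounded_borel_features i : bounded_borel (nth (fun=> 0) (features R) i).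
Proof.
have mV : measurable_fun setT (fun z : BorelC R => (phi z)^-1).
  have -> : (fun z : BorelC R => (phi z)^-1) = fun z => expR (- ln (phi z)).
    by apply/funext => z; rewrite expRN lnK ?posrE ?phi_gt0.
  apply: measurableT_comp => //; apply: measurableT_comp => //.
  by apply: measurableT_comp => //; exact: measurable_phi.
have bound (a : R) z : a ^+ 2 <= modulus z ^+ 2 -> `|a / phi z| <= 1.
  move=> az; rewrite normrM normfV (ger0_norm (ltW (phi_gt0 z))).
  rewrite ler_pdivrMr ?phi_gt0 // mul1r /phi.
  by have := sqr_ge0 (modulus z); have := sqr_ge0 (`|a| - 1);
    rewrite sqrrB1 real_normK ?num_real //; lra.
have bRe : bounded_borel (fun u => if u is Some z then complex.Re z / phi z else 0).
  split; first by apply: measurable_funM => //; exact: measurable_Re.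
  exists 1 => -[z|]; last by rewrite normr0.
  by apply: bound; rewrite modulus_sqr lerDl sqr_ge0.
have bIm : bounded_borel (fun u => if u is Some z then complex.Im z / phi z else 0).
  split; first by apply: measurable_funM => //; exact: measurable_Im.
  exists 1 => -[z|]; last by rewrite normr0.
  by apply: bound; rewrite modulus_sqr lerDr sqr_ge0.
case: i => [|[|[|[|[|[|i]]]]]] //=; last by rewrite nth_nil; exact: bounded_borel_cst.
- split=> //; exists 1 => -[z|]; last by rewrite normr0.
  by rewrite ger0_norm ?invr_ge0 ?(ltW (phi_gt0 z)) // invf_le1 ?phi_gt0 // phi_ge1.
- split.
    apply: measurable_funM => //; apply: measurable_funX; exact: measurable_modulus.
  exists 1 => -[z|]; last by rewrite normr1.
  rewrite ger0_norm ?divr_ge0 ?sqr_ge0 ?(ltW (phi_gt0 z)) // ler_pdivrMr ?phi_gt0 //.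
  by rewrite mul1r /phi lerDr.
Qed.

Lemma sph_nth u v : sph u v = \sum_(i < 6) nth (fun=> 0) (features R) i u *
  nth (fun=> 0) (features R) i v :> R.
Proof. by rewrite /sph (big_nth (fun=> 0)) big_mkord. Qed.

Lemma bounded_borel_kap u : bounded_borel (kap e u).
Proof.
split; last first.
  exists (- ln e) => v; have /andP[k0 k1] := kap_ge0_le e_gt0 e_lt1 u v.
  by rewrite ger0_norm.
apply: measurableT_comp => //; apply: measurableT_comp => //.
apply: measurable_funB => //; apply: measurable_funM => //.
under eq_fun do rewrite sph_nth.
apply: measurable_sum => i; apply: measurable_funM => //.
by have [] := bounded_borel_features i.
Qed.

Lemma measurable_kap2 : measurable_fun setT
  (fun p : BorelC R * BorelC R => kap e (Some p.1) (Some p.2)).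
Proof.
apply: measurableT_comp => //; apply: measurableT_comp => //.
apply: measurable_funB => //; apply: measurable_funM => //.
under eq_fun do rewrite sph_nth.
apply: measurable_sum => i; have [mf _] := bounded_borel_features i.
by apply: measurable_funM;
  [apply: (measurableT_comp mf measurable_fst)|apply: (measurableT_comp mf measurable_snd)].
Qed.

Lemma integral_bounded_borel f : bounded_borel f ->
  (\int[mu]_t (f (Some t))%:E = (avg E mu (f \o Some))%:E)%E.
Proof.
move=> /bounded_borel_admissible af; apply/eqP; rewrite eq_le.
by rewrite (integral_le_avg cE muE af) ?(integral_ge_avg cE muE af).
Qed.

Lemma bounded_borel_avg_kap :
  bounded_borel (fun u => avg E mu (kap e u \o Some)).
Proof.
split.
  apply/measurable_EFinP.
  have := @measurable_fun_fubini_tonelli_F _ _ (BorelC R) (BorelC R) R mu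
    (fun p => (kap e (Some p.1) (Some p.2))%:E).
  rewrite /fubini_F /= => mF; apply: eq_measurable_fun (mF _ _).
  - by move=> z _; rewrite /= (integral_bounded_borel (bounded_borel_kap (Some z))).
  - by apply/measurable_EFinP; exact: measurable_kap2.
  - by move=> p; rewrite lee_fin; have /andP[] := kap_ge0_le e_gt0 e_lt1 (Some p.1) (Some p.2).
exists (- ln e) => u; apply: (avg_norm_le cE muE).
  by apply: bounded_borel_admissible; exact: bounded_borel_kap.
move=> t _; have /andP[k0 k1] := kap_ge0_le e_gt0 e_lt1 u (Some t).
by rewrite ger0_norm.
Qed.

Definition charge_functional (L : (option (Cplx R) -> R) -> R) : Prop :=
  bounded_functional bounded_borel L /\ bounded_borel (fun u => L (kap e u)).

Lemma charge_point u : charge_functional (fun f => f u).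
Proof.
split; last by under eq_fun do rewrite kapC; exact: bounded_borel_kap.
by split => //; exists 1 => // f M _ fM; rewrite mul1r.
Qed.

Lemma charge_avg : charge_functional (fun f => avg E mu (f \o Some)).
Proof.
split; last exact: bounded_borel_avg_kap.
split.
- by move=> f g bf bg; rewrite -(avgD cE muE) //; exact: bounded_borel_admissible.
- by move=> c f bf; rewrite -(avgZ cE muE) //; exact: bounded_borel_admissible.
- exists 1 => // f M bf fM; rewrite mul1r; apply: (avg_norm_le cE muE) => [|t _].
    exact: bounded_borel_admissible.
  exact: fM.
Qed.

Lemma charge_lin a L1 L2 : charge_functional L1 -> charge_functional L2 ->
  charge_functional (fun f => L1 f + a * L2 f).
Proof.
move=> [[D1 Z1 [C1 C10 b1]] m1] [[D2 Z2 [C2 C20 b2]] m2]; split; last first.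
  by apply: bounded_borelD => //; apply: bounded_borelM => //; exact: bounded_borel_cst.
split.
- by move=> f g bf bg; rewrite D1 // D2 //; ring.
- by move=> c f bf; rewrite Z1 // Z2 //; ring.
- exists (C1 + `|a| * C2); first by rewrite addr_ge0 ?mulr_ge0.
  move=> f M bf fM; rewrite mulrDl; apply: le_trans (ler_normD _ _) _.
  by rewrite lerD ?b1 // normrM -mulrA ler_wpM2l ?b2.
Qed.

Lemma charge_sum n (p : 'I_n -> option (Cplx R)) :
  charge_functional (fun f => \sum_i f (p i)).
Proof.
elim: n p => [|n IH] p.
  under eq_fun do rewrite big_ord0; split; last exact: bounded_borel_cst.
  split; [by move=> *; rewrite addr0|by move=> *; rewrite mulr0|exists 0 => //].
  by move=> f M _ _; rewrite normr0 mul0r.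
have -> : (fun f : option (Cplx R) -> R => \sum_i f (p i)) =
    fun f => \sum_i f (p (widen_ord (leqnSn n) i)) + 1 * f (p ord_max).
  by apply/funext => f; rewrite big_ord_recr mul1r.
apply: (charge_lin 1 (IH (p \o widen_ord (leqnSn n)))); exact: charge_point.
Qed.

Lemma charge_energy_ge0 L : charge_functional L -> 0 <= L (fun u => L (kap e u)).
Proof.
move=> [bL mL]; rewrite /kap; have e01 : 0 <= 1 - e by rewrite subr_ge0 ltW.
apply: (ln_kernel_ge0 bounded_borel_cst bounded_borelD bounded_borelM bL) => //.
- by exists (features R) => // i; exact: bounded_borel_features.
- exact: sph_ge0_le1.
- by rewrite gtrBl.
- exact: bounded_borel_kap.
Qed.

Lemma charge_potential_le L u : charge_functional L ->
  L (kap e u) ^+ 2 <= - ln e * L (fun v => L (kap e v)).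
Proof.
move=> cL; have le0 : 0 < - ln e by rewrite oppr_gt0 ln_lt0 // e_gt0.
set p := L (kap e u); set q := L _.
have := charge_energy_ge0 (charge_lin (- (p / - ln e)) cL (charge_point u)).
have [[LD LZ _] mL] := cL.
rewrite kap_diag -/p.
have -> : (fun v => L (kap e v) + - (p / - ln e) * kap e v u) =
    (fun v => L (kap e v) + - (p / - ln e) * kap e u v).
  by apply/funext => v; rewrite kapC.
have bk := bounded_borel_kap u.
rewrite LD //; last by apply: bounded_borelM => //; exact: bounded_borel_cst.
rewrite LZ // -/p -/q => h.
have : 0 <= (q - p ^+ 2 / - ln e) * - ln e.
  rewrite mulr_ge0 ?(ltW le0) //; apply: le_trans h _; rewrite le_eqVlt; apply/orP; left.
  by apply/eqP; field; rewrite -oppr_eq0 gt_eqF.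
by rewrite mulrBl divfK ?gt_eqF //; lra.
Qed.

End EnergyForm.

(** * The maximum principle *)

Section MaximumPrinciple.
Variables (R : realType) (E : set (Cplx R)) (mu : probability (BorelC R) R).
Variables (rho V CE s : R).
Hypotheses (cE : compact E) (muE : supported_on E mu).
Hypotheses (rho_ge1 : 1 <= rho) (E_rho : forall t, E t -> modulus t <= rho).
Hypotheses (robinE : robin E = V%:E) (CE_gt0 : 0 < CE) (s_gt0 : 0 < s).
Hypothesis (holder : holder_green E mu CE s).

Lemma admissible_ln (g : Cplx R -> R) a b :
  measurable_fun setT (g : BorelC R -> R) -> 0 < a ->
  (forall t, E t -> a <= g t <= b) -> admissible E (fun t => ln (g t)).
Proof.
move=> mg a0 gab; split; first exact: measurableT_comp.
exists (`|ln a| + `|ln b|) => t /gab/andP[ag gb].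
have g0 : 0 < g t by exact: lt_le_trans ag.
have : ln a <= ln (g t) by rewrite ler_ln ?posrE.
have : ln (g t) <= ln b by rewrite ler_ln ?posrE //; exact: lt_le_trans gb.
have := ler_norm (ln b); have := ler_norm (- ln a); rewrite normrN => *.
have := normr_ge0 (ln b); have := normr_ge0 (ln a).
by rewrite ler_norml; lra.
Qed.

Lemma measurable_modulusB z :
  measurable_fun setT (fun t : BorelC R => modulus (z - t)).
Proof.
apply: continuous_measurable_BorelC; apply: lipschitz1_continuous => w w'.
have := modulus_tri w z w'; have := modulus_tri w' z w.
by rewrite (modulusC w' w) ler_norml; lra.
Qed.

Lemma measurable_modulusB2 z c :
  measurable_fun setT (fun t : BorelC R => modulus (z - t) ^+ 2 + c).
Proof.
by apply: measurable_funD => //; apply: measurable_funX; exact: measurable_modulusB.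
Qed.

Lemma modulusB_le_rho z t : E t -> modulus (z - t) <= modulus z + rho.
Proof.
by move=> /E_rho tr; have := modulusD z (- t); rewrite modulusN; lra.
Qed.

Lemma admissible_smooth z d : 0 < d ->
  admissible E (fun t => ln (modulus (z - t) ^+ 2 + d ^+ 2)).
Proof.
move=> d0; apply: (@admissible_ln _ (d ^+ 2) ((modulus z + rho) ^+ 2 + d ^+ 2)).
- exact: measurable_modulusB2.
- by rewrite exprn_gt0.
- move=> t Et; rewrite lerDr sqr_ge0 lerD2r ler_sqr ?nnegrE ?modulus_ge0 //.
    exact: modulusB_le_rho.
  by rewrite addr_ge0 ?modulus_ge0 // (le_trans ler01).
Qed.

Lemma admissible_far z a : 0 < a -> (forall t, E t -> a <= modulus (z - t)) ->
  admissible E (fun t => ln (modulus (z - t) ^+ 2)).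
Proof.
move=> a0 aE; apply: (@admissible_ln _ (a ^+ 2) ((modulus z + rho) ^+ 2)).
- by apply: measurable_funX; exact: measurable_modulusB.
- by rewrite exprn_gt0.
- move=> t Et; rewrite !ler_sqr ?nnegrE ?modulus_ge0 ?(ltW a0) //.
    by rewrite aE // modulusB_le_rho.
  by rewrite addr_ge0 ?modulus_ge0 // (le_trans ler01).
Qed.

Lemma log_kernelE (z t : Cplx R) : 0 < modulus (z - t) ->
  log_kernel z t = (- 2^-1 * ln (modulus (z - t) ^+ 2))%:E.
Proof.
move=> zt; rewrite /log_kernel lne_EFin // lnXn //.
by rewrite -EFinN; congr EFin; field.
Qed.

Lemma potential_far z a : 0 < a -> (forall t, E t -> a <= modulus (z - t)) ->
  potential mu z = (- 2^-1 * avg E mu (fun t => ln (modulus (z - t) ^+ 2)))%:E.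
Proof.
move=> a0 aE; have af := admissible_far a0 aE.
have zt t : E t -> 0 < modulus (z - t) by move=> /aE; exact: lt_le_trans.
rewrite -(avgZ cE muE) //; apply/eqP; rewrite eq_le /potential.
rewrite (integral_le_avg cE muE (admissibleZ _ af)) /=; last first.
  by move=> t Et; rewrite log_kernelE ?zt.
rewrite (integral_ge_avg cE muE (admissibleZ _ af)) //.
by move=> t Et; rewrite log_kernelE ?zt.
Qed.

Lemma dist_le z t : E t -> dist E z <= modulus (z - t).
Proof.
move=> Et; apply: ge_inf; last by exists t.
by exists 0 => _ [x _ <-]; exact: modulus_ge0.
Qed.

Lemma dist_ge0 z : 0 <= dist E z.
Proof.
apply: lb_le_inf; last by move=> _ [x _ <-]; exact: modulus_ge0.
by have [t Et] := support_nonempty cE muE; exists (modulus (z - t)); exists t.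
Qed.

Lemma stencil_ln (a b d A : R) : 0 < d -> a ^+ 2 + b ^+ 2 + d ^+ 2 <= A ->
  4 * ln (a ^+ 2 + b ^+ 2 + d ^+ 2) + ln (1 + 2 * (d ^+ 2 / A) ^+ 2) <=
  ln ((a + d) ^+ 2 + b ^+ 2 + d ^+ 2) + ln ((a - d) ^+ 2 + b ^+ 2 + d ^+ 2) +
  ln (a ^+ 2 + (b + d) ^+ 2 + d ^+ 2) + ln (a ^+ 2 + (b - d) ^+ 2 + d ^+ 2).
Proof.
move=> d0 XA; have D0 : 0 < d ^+ 2 by rewrite exprn_gt0.
have pos x y : 0 < x ^+ 2 + y ^+ 2 + d ^+ 2.
  by rewrite ltr_wpDl // addr_ge0 ?sqr_ge0.
have X0 := pos a b; set X := a ^+ 2 + b ^+ 2 + d ^+ 2 in X0 XA *.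
have A0 : 0 < A by exact: lt_le_trans XA.
have q0 : 0 < 1 + 2 * (d ^+ 2 / A) ^+ 2 by have := sqr_ge0 (d ^+ 2 / A); lra.
rewrite mulr_natl -lnXn // -!lnM ?posrE ?mulr_gt0 ?exprn_gt0 ?pos //.
rewrite ler_ln ?posrE ?mulr_gt0 ?exprn_gt0 ?pos //.
apply: (@le_trans _ _ (X ^+ 4 + 2 * (d ^+ 2) ^+ 2 * X ^+ 2)).
  rewrite mulrDr mulr1 lerD2l expr_div_n.
  have -> : X ^+ 4 * (2 * ((d ^+ 2) ^+ 2 / A ^+ 2)) =
      2 * (d ^+ 2) ^+ 2 * X ^+ 2 * (X ^+ 2 / A ^+ 2) by ring.
  apply: ler_piMr; first by apply: mulr_ge0 (sqr_ge0 _); apply: mulr_ge0 (sqr_ge0 _).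
  rewrite ler_pdivrMr ?exprn_gt0 // mul1r.
  by rewrite ler_sqr ?nnegrE // ltW.
rewrite -subr_ge0 /X; set D := d ^+ 2 in D0 *.
have -> : ((a + d) ^+ 2 + b ^+ 2 + D) * ((a - d) ^+ 2 + b ^+ 2 + D) *
    (a ^+ 2 + (b + d) ^+ 2 + D) * (a ^+ 2 + (b - d) ^+ 2 + D) -
    ((a ^+ 2 + b ^+ 2 + D) ^+ 4 + 2 * D ^+ 2 * (a ^+ 2 + b ^+ 2 + D) ^+ 2) =
    5 * D ^+ 4 + 8 * (D ^+ 3 * (a ^+ 2 + b ^+ 2 + D)) + 16 * (D * a * b) ^+ 2.
  by rewrite /D; ring.
have := exprn_gt0 3 D0; have := exprn_gt0 4 D0; have := sqr_ge0 (D * a * b); nra.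
Qed.

Definition smooth_avg (d : R) (z : Cplx R) : R :=
  avg E mu (fun t => ln (modulus (z - t) ^+ 2 + d ^+ 2)).

Lemma stencil_avg (d B : R) z : 0 < d -> modulus z <= B ->
  4 * smooth_avg d z + ln (1 + 2 * (d ^+ 2 / ((B + rho) ^+ 2 + d ^+ 2)) ^+ 2) <=
  smooth_avg d (z + (d +i* 0)%C) + smooth_avg d (z + (- d +i* 0)%C) +
  smooth_avg d (z + (0 +i* d)%C) + smooth_avg d (z + (0 +i* - d)%C).
Proof.
move=> d0 zB; have as_ w := admissible_smooth w d0.
set k := ln (1 + _).
rewrite /smooth_avg -(avgZ cE muE) // -{1}(avg_cst cE muE k).
rewrite -!(avgD cE muE) //;
  do ?[exact: as_|exact: admissible_cst|apply: admissibleZ|apply: admissibleD].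
apply: (avg_le cE muE);
  do ?[exact: as_|exact: admissible_cst|apply: admissibleZ|apply: admissibleD].
move=> t Et; have := modulusB_le_rho z Et; rewrite !modulus_sqr => ztB.
have A1 : modulus (z - t) ^+ 2 + d ^+ 2 <= (B + rho) ^+ 2 + d ^+ 2.
  rewrite lerD2r ler_sqr ?nnegrE ?modulus_ge0 //; first by lra.
  have := modulus_ge0 z; have := rho_ge1; lra.
move: A1; rewrite modulus_sqr {}/k {ztB}; case: z t {zB Et} => [a b] [x y] /= A1.
have := stencil_ln d0 A1.
have -> : a + d - x = a - x + d by ring.
have -> : a - d - x = a - x - d by ring.
have -> : b + d - y = b - y + d by ring.
have -> : b - d - y = b - y - d by ring.
by rewrite !addr0; lra.
Qed.

Lemma smooth_avg_far d r w : 0 < d -> 0 < r -> Omega E (Some w) ->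
  (forall t, E t -> r <= modulus (w - t)) ->
  (exists2 t, E t & modulus (w - t) <= 2 * r) ->
  smooth_avg d w <= - 2 * V + 2 * (CE * (2 * r) `^ s) + d ^+ 2 / r ^+ 2.
Proof.
move=> d0 r0 Ow wr [t Et wt].
have af := admissible_far r0 wr.
apply: (@le_trans _ _ (avg E mu (fun t => ln (modulus (w - t) ^+ 2)) + d ^+ 2 / r ^+ 2)).
  rewrite -{1}(avg_cst cE muE (d ^+ 2 / r ^+ 2)) -(avgD cE muE) //; last exact: admissible_cst.
  apply: (avg_le cE muE); first exact: admissible_smooth.
    by apply: admissibleD => //; exact: admissible_cst.
  move=> x Ex; have rx := wr _ Ex.
  have m1 : 0 < modulus (w - x) by exact: lt_le_trans rx.
  have m0 : 0 < modulus (w - x) ^+ 2 by rewrite exprn_gt0.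
  have -> : modulus (w - x) ^+ 2 + d ^+ 2 =
      modulus (w - x) ^+ 2 * (1 + d ^+ 2 / modulus (w - x) ^+ 2).
    by rewrite mulrDr mulr1 mulrC -mulrA mulVf ?mulr1 // gt_eqF.
  have q0 : 0 <= d ^+ 2 / modulus (w - x) ^+ 2 by rewrite divr_ge0 ?sqr_ge0.
  rewrite lnM ?posrE //; last by rewrite ltr_wpDr.
  rewrite lerD2l; apply: le_trans (le_ln1Dx _) _; first by lra.
  rewrite ler_wpM2l ?sqr_ge0 // lef_pV2 ?posrE ?exprn_gt0 //.
  by rewrite ler_sqr ?nnegrE ?modulus_ge0 // ltW.
rewrite lerD2r; have := holder Ow; rewrite /green robinE (potential_far r0 wr).
rewrite -EFinN -EFinD lee_fin => VU.
have : CE * dist E w `^ s <= CE * (2 * r) `^ s.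
  rewrite ler_pM2l // ge0_ler_powR ?nnegrE ?(ltW s_gt0) ?dist_ge0 //; first by lra.
  exact: le_trans (dist_le _ Et) wt.
by lra.
Qed.

(* The maximum principle for the strictly subharmonic function [smooth_avg d],
   on the bounded set of points that are not at distance [>= r] from [E] in
   [Omega E]: near a maximum, the four-point stencil must leave that set. *)
Lemma smooth_avg_le d r z : 0 < d -> d < r -> E z ->
  smooth_avg d z <= - 2 * V + 2 * (CE * (2 * r) `^ s) + d ^+ 2 / r ^+ 2.
Proof.
move=> d0 dr Ez; set B := leRHS; have r0 : 0 < r by exact: lt_trans dr.
pose S := [set w | ~ (Omega E (Some w) /\ forall t, E t -> r <= modulus (w - t))].
have Srho w : S w -> modulus w <= rho + r.
  move=> Sw; rewrite leNgt; apply/negP => wr; apply: Sw; split.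
    apply: (Omega_far E_rho); first by have := rho_ge1; lra.
    by lra.
  move=> t /E_rho tr; have := modulus_tri t w 0; rewrite !subr0.
  by lra.
have Sz : S z by case=> _ /(_ z Ez); rewrite subrr modulus0; lra.
have bound w : S w ->
    smooth_avg d w <= ln ((rho + r + rho) ^+ 2 + d ^+ 2).
  move=> Sw; rewrite -(avg_cst cE muE (ln _)); apply: (avg_le cE muE).
  - exact: admissible_smooth.
  - exact: admissible_cst.
  - move=> t Et; have h := modulusB_le_rho w Et; have Sw' := Srho _ Sw.
    have D0 : 0 < d ^+ 2 by rewrite exprn_gt0.
    rewrite ler_ln ?posrE ?ltr_wpDl ?sqr_ge0 // lerD2r ler_sqr ?nnegrE ?modulus_ge0 //.
      by lra.
    by have := rho_ge1; lra.
have nbr w v : S w -> modulus v = d -> ~ S (w + v) -> smooth_avg d (w + v) <= B.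
  move=> Sw vd /contrapT[Owv wvr].
  have Ow : Omega E (Some w).
    have wv : modulus (w - (w + v)) = d by rewrite opprD addrA subrr sub0r modulusN.
    apply: Omega_segment Owv => x; rewrite wv.
    by move=> xd /wvr; rewrite modulusC; lra.
  apply: (@smooth_avg_far d r) => //.
  have /existsNP[t /not_implyP[Et /negP]] : ~ forall t, E t -> r <= modulus (w - t).
    by move=> wr; exact: Sw.
  rewrite -ltNge => wt; exists t => //.
  have := modulus_tri w (w + v) t; rewrite [w + v - w]addrC addKr vd; lra.
rewrite leNgt; apply/negP => Bz.
pose G := smooth_avg d @` S.
have Gsup : has_sup G.
  split; first by exists (smooth_avg d z); exists z.
  by exists (ln ((rho + r + rho) ^+ 2 + d ^+ 2)) => _ [w Sw <-]; exact: bound.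
set k := ln (1 + 2 * (d ^+ 2 / ((rho + r + rho) ^+ 2 + d ^+ 2)) ^+ 2).
have k0 : 0 < k.
  rewrite /k ln_gt0 // ltrDl mulr_gt0 // exprn_gt0 // divr_gt0 ?exprn_gt0 //.
  by rewrite ltr_wpDl ?sqr_ge0 ?exprn_gt0.
have zG : smooth_avg d z <= sup G by apply: ub_le_sup; [case: Gsup|exists z].
have [_ [w Sw <-] Gw] : exists2 x, G x & Num.max B (sup G - k / 4) < x.
  case: (leP B (sup G - k / 4)) => hB.
    have [x Gx hx] := sup_adherent (divr_gt0 k0 (ltr0Sn R 3)) Gsup.
    by exists x.
  by exists (smooth_avg d z) => //; exists z.
move: Gw; rewrite gt_max => /andP[BGw kGw].
have nb v : modulus v = d -> smooth_avg d (w + v) < smooth_avg d w + k / 4.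
  move=> vd; case: (pselect (S (w + v))) => Sv.
    have : smooth_avg d (w + v) <= sup G by apply: ub_le_sup; [case: Gsup|exists (w + v)].
    by lra.
  by have := nbr _ _ Sw vd Sv; have := divr_gt0 k0 (ltr0Sn R 3); lra.
have md (x y : R) : x ^+ 2 + y ^+ 2 = d ^+ 2 -> modulus ((x +i* y)%C : Cplx R) = d.
  move=> xy; rewrite /modulus /= xy sqrtr_sqr gtr0_norm //.
have := stencil_avg d0 (Srho _ Sw); rewrite -/k.
have := nb (d +i* 0)%C (md _ _ _); have := nb (- d +i* 0)%C (md _ _ _).
have := nb (0 +i* d)%C (md _ _ _); have := nb (0 +i* - d)%C (md _ _ _).
rewrite expr0n !sqrrN addr0 add0r => /(_ erefl) + /(_ erefl) + /(_ erefl) + /(_ erefl).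
by lra.
Qed.

End MaximumPrinciple.

(** * Energies of the regularized kernel *)

Section EquilibriumEnergy.
Variables (R : realType) (E : set (Cplx R)) (mu : probability (BorelC R) R).
Variables (rho V : R).
Hypotheses (cE : compact E) (equil : equilibrium_measure E mu).
Hypotheses (rho_ge1 : 1 <= rho) (E_rho : forall t, E t -> modulus t <= rho).

Let muE : supported_on E mu. Proof. by case: equil. Qed.

Lemma log_kernel_pinfty (z t : Cplx R) : modulus (z - t) = 0 -> log_kernel z t = +oo%E.
Proof. by move=> zt; rewrite /log_kernel zt le0_lneNy. Qed.

Lemma log_kernel_ge (z t : Cplx R) q : 0 < q -> modulus (z - t) ^+ 2 <= q ->
  ((2^-1 * - ln q)%:E <= log_kernel z t)%E.
Proof.
move=> q0 ztq; have [m0|m0] := eqVneq (modulus (z - t)) 0.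
  by rewrite log_kernel_pinfty // leey.
have mp : 0 < modulus (z - t) by rewrite lt_def m0 modulus_ge0.
rewrite log_kernelE // lee_fin mulrN mulNr lerN2 ler_pM2l ?invr_gt0 //.
by rewrite ler_ln ?posrE ?exprn_gt0.
Qed.

Lemma energy_ge_avg (f : Cplx R -> R) : admissible E f ->
  (forall z, E z -> ((f z)%:E <= potential mu z)%E) ->
  ((avg E mu f)%:E <= robin E)%E.
Proof.
move=> af fE; case: equil => _ <-.
exact: (integral_ge_avg cE muE).
Qed.

Lemma robin_fin_num : (0 < capacity E)%E -> robin E \is a fin_num.
Proof.
move=> cap0; rewrite fin_numE; apply/andP; split; last first.
  by apply/eqP => robE; move: cap0; rewrite /capacity robE /= ltxx.
rewrite -ltNye; apply: (@lt_le_trans _ _ (2^-1 * - ln ((rho + rho) ^+ 2))%:E).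
  exact: ltNyr.
have r0 : 0 < rho + rho by have := rho_ge1; lra.
rewrite -(avg_cst cE muE (2^-1 * _)); apply: energy_ge_avg; first exact: admissible_cst.
move=> z Ez; rewrite -(avg_cst cE muE (2^-1 * _)).
apply: (integral_ge_avg cE muE); first exact: admissible_cst.
move=> t Et; apply: log_kernel_ge; first by rewrite exprn_gt0.
rewrite ler_sqr ?nnegrE ?modulus_ge0 ?(ltW r0) //.
by have := modulusD z (- t); rewrite modulusN; have := E_rho Ez; have := E_rho Et; lra.
Qed.

Hypothesis robinE : robin E = V%:E.
Variable e : R.
Hypotheses (e_gt0 : 0 < e) (e_lt1 : e < 1).

(* [reg_potential], [reg_energy] and [reg_deviation] are built on
   [- ln (reg e z t)] ~ [2 log (1 / |z - t|)]: they are twice the regularized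
   potential, discrete energy and deviation. *)
Definition reg_potential z : R := avg E mu (fun t => - ln (reg e z t)).

Definition log_phi_mean : R := avg E mu (fun t => ln (phi t)).

Lemma phi_le_rho t : E t -> phi t <= 1 + rho ^+ 2.
Proof.
move=> Et; rewrite /phi lerD2l ler_sqr ?nnegrE ?modulus_ge0 ?E_rho //.
by have := rho_ge1; lra.
Qed.

Lemma admissible_ln_phi : admissible E (fun t => ln (phi t)).
Proof.
apply: (@admissible_ln _ _ _ 1 (1 + rho ^+ 2)) => //; first exact: measurable_phi.
by move=> t Et; rewrite phi_ge1 phi_le_rho.
Qed.

Lemma admissible_kap u : admissible E (kap e u \o Some).
Proof. by apply: bounded_borel_admissible; exact: bounded_borel_kap. Qed.

Lemma admissible_reg z : admissible E (fun t => - ln (reg e z t)).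
Proof.
have -> : (fun t => - ln (reg e z t)) =
    fun t => (kap e (Some z) \o Some) t + - (ln (phi z) + ln (phi t)).
  by apply/funext => t; rewrite /= kap_reg //; ring.
apply: admissibleD; first exact: admissible_kap.
apply: admissibleN; apply: admissibleD; first exact: admissible_cst.
exact: admissible_ln_phi.
Qed.

Lemma reg_potentialE z : avg E mu (kap e (Some z) \o Some) =
  reg_potential z + ln (phi z) + log_phi_mean.
Proof.
have -> : kap e (Some z) \o Some =
    fun t => - ln (reg e z t) + (ln (phi z) + ln (phi t)).
  by apply/funext => t; rewrite /= kap_reg //; ring.
have acst : admissible E (fun t => ln (phi z) + ln (phi t)).
  by apply: admissibleD; [exact: admissible_cst|exact: admissible_ln_phi].
have areg := admissible_reg z.
rewrite (avgD cE muE) // (avgD cE muE) ?(avg_cst cE muE) ?addrA //.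
  exact: admissible_cst.
exact: admissible_ln_phi.
Qed.

Lemma admissible_reg_potential : admissible E reg_potential.
Proof.
have -> : reg_potential = fun z =>
    avg E mu (kap e (Some z) \o Some) + - (ln (phi z) + log_phi_mean).
  by apply/funext => z; rewrite reg_potentialE; ring.
apply: admissibleD.
  apply: (@bounded_borel_admissible _ _ (fun u => avg E mu (kap e u \o Some))).
  exact: bounded_borel_avg_kap.
apply: admissibleN; apply: admissibleD; first exact: admissible_ln_phi.
exact: admissible_cst.
Qed.

Lemma avg_reg_potential_le : avg E mu reg_potential <= 2 * V.
Proof.
suff : 2^-1 * avg E mu reg_potential <= V by lra.
rewrite -(avgZ cE muE); last exact: admissible_reg_potential.
rewrite -lee_fin -robinE; apply: energy_ge_avg.
  by apply: admissibleZ; exact: admissible_reg_potential.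
move=> z Ez; rewrite -(avgZ cE muE); last exact: admissible_reg.
apply: (integral_ge_avg cE muE); first by apply: admissibleZ; exact: admissible_reg.
move=> t Et; apply: log_kernel_ge; first exact: reg_gt0.
exact: reg_ge.
Qed.

Section Points.
Variables (n : nat) (Z : 'I_n -> Cplx R).
Hypotheses (n_gt0 : (0 < n)%N) (EZ : forall k, E (Z k)).

Definition reg_energy : R := n%:R^-1 * (n%:R^-1 * \sum_i \sum_j - ln (reg e (Z i) (Z j))).

Definition reg_deviation z : R :=
  reg_potential z - n%:R^-1 * \sum_i - ln (reg e z (Z i)).

Let mean_cst c : n%:R^-1 * \sum_(i < n) c = c :> R.
Proof.
by rewrite sumr_const card_ord -[c *+ n]mulr_natl mulrA mulVf ?mul1r // pnatr_eq0 -lt0n.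
Qed.

Let A := n%:R^-1 * \sum_i ln (phi (Z i)).

Let L (f : option (Cplx R) -> R) : R :=
  avg E mu (f \o Some) + - n%:R^-1 * \sum_i f (Some (Z i)).

Let chargeL : charge_functional e L.
Proof. by apply: charge_lin; [exact: charge_avg|exact: charge_sum]. Qed.

Let L_point z : L (kap e (Some z)) = reg_deviation z + (log_phi_mean - A).
Proof.
rewrite /L reg_potentialE /reg_deviation.
have -> : \sum_i kap e (Some z) (Some (Z i)) =
    \sum_i - ln (reg e z (Z i)) + (\sum_(i < n) ln (phi z) + \sum_i ln (phi (Z i))).
  by rewrite -!big_split; apply: eq_bigr => i _; rewrite /= kap_reg //; ring.
by rewrite mulNr !mulrDr mean_cst -/A; ring.
Qed.

Let L_infty : `|L (kap e None) - (log_phi_mean - A)| <= e * rho ^+ 2.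
Proof.
have al : admissible E (fun t => ln (1 + e * modulus t ^+ 2)).
  apply: (@admissible_ln _ _ _ 1 (1 + e * rho ^+ 2)) => //.
    apply: measurable_funD => //; apply: measurable_funM => //.
    by apply: measurable_funX; exact: measurable_modulus.
  move=> t Et; rewrite lerDl mulr_ge0 ?(ltW e_gt0) ?sqr_ge0 //= lerD2l ler_pM2l //.
  rewrite ler_sqr ?nnegrE ?modulus_ge0 ?E_rho //.
  by have := rho_ge1; lra.
have bnd t : E t -> 0 <= ln (1 + e * modulus t ^+ 2) <= e * rho ^+ 2.
  move=> Et; have m0 : 0 <= e * modulus t ^+ 2 by rewrite mulr_ge0 ?(ltW e_gt0) ?sqr_ge0.
  rewrite ln_ge0 ?lerDl //=; apply: le_trans (le_ln1Dx _) _; first by lra.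
  rewrite ler_pM2l // ler_sqr ?nnegrE ?modulus_ge0 ?E_rho //.
  by have := rho_ge1; lra.
have -> : L (kap e None) - (log_phi_mean - A) =
    n%:R^-1 * (\sum_i ln (1 + e * modulus (Z i) ^+ 2)) -
    avg E mu (fun t => ln (1 + e * modulus t ^+ 2)).
  rewrite /L.
  have -> : kap e None \o Some = fun t => ln (phi t) + - ln (1 + e * modulus t ^+ 2).
    by apply/funext => t; rewrite /= kap_infty.
  have -> : \sum_i kap e None (Some (Z i)) =
      \sum_i ln (phi (Z i)) - \sum_i ln (1 + e * modulus (Z i) ^+ 2).
    by rewrite -sumrB; apply: eq_bigr => i _; rewrite kap_infty.
  rewrite (avgD cE muE) ?(avgN cE muE) //; last first.
    exact: admissibleN.
    exact: admissible_ln_phi.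
  by rewrite mulNr mulrBr -/A -/log_phi_mean; ring.
have h1 : 0 <= avg E mu (fun t => ln (1 + e * modulus t ^+ 2)).
  rewrite -(avg_cst cE muE 0); apply: (avg_le cE muE) => //; first exact: admissible_cst.
  by move=> t /bnd/andP[].
have h2 : avg E mu (fun t => ln (1 + e * modulus t ^+ 2)) <= e * rho ^+ 2.
  rewrite -(avg_cst cE muE (e * _)); apply: (avg_le cE muE) => //; first exact: admissible_cst.
  by move=> t /bnd/andP[].
have h3 : 0 <= n%:R^-1 * (\sum_i ln (1 + e * modulus (Z i) ^+ 2)).
  by rewrite mulr_ge0 ?invr_ge0 // sumr_ge0 // => i _; have /andP[] := bnd _ (EZ i).
have h4 : n%:R^-1 * (\sum_i ln (1 + e * modulus (Z i) ^+ 2)) <= e * rho ^+ 2.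
  rewrite -(mean_cst (e * _)) ler_wpM2l ?invr_ge0 // ler_sum // => i _.
  by have /andP[] := bnd _ (EZ i).
by rewrite ler_norml; lra.
Qed.

Let L_energy : L (fun u => L (kap e u)) =
  reg_energy - 2 * (n%:R^-1 * \sum_i reg_potential (Z i)) + avg E mu reg_potential.
Proof.
rewrite {1}/L.
have -> : (fun u => L (kap e u)) \o Some =
    fun z => reg_potential z + (ln (phi z) +
      (- n%:R^-1 * (\sum_i kap e (Some (Z i)) (Some z)) + log_phi_mean)).
  apply/funext => z; rewrite /L /= reg_potentialE.
  rewrite (eq_bigr (fun i => kap e (Some (Z i)) (Some z))); last by move=> i _; rewrite kapC.
  ring.
have ak i : admissible E (fun z => kap e (Some (Z i)) (Some z)) by exact: admissible_kap.
have as_ := admissible_sum (index_enum 'I_n) ak.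
have aZ := admissibleZ (- n%:R^-1) as_.
have ac := admissible_cst E log_phi_mean.
have alp := admissible_ln_phi; have ar := admissible_reg_potential.
have aD := admissibleD aZ ac; have aD2 := admissibleD alp aD.
rewrite !(avgD cE muE) // (avgZ cE muE) // (avg_sum cE muE) // (avg_cst cE muE).
rewrite (eq_bigr (fun i => reg_potential (Z i) + ln (phi (Z i)) + log_phi_mean)); last first.
  by move=> i _; exact: reg_potentialE.
have -> : \sum_i L (kap e (Some (Z i))) = \sum_i (reg_deviation (Z i) + (log_phi_mean - A)).
  by apply: eq_bigr => i _; exact: L_point.
rewrite !big_split /= sumrN -mulr_sumr -/log_phi_mean /reg_energy.
rewrite !mulrDr !mulNr !mean_cst -/A; ring.
Qed.

Lemma reg_energy_ge : 2 * (n%:R^-1 * \sum_i reg_potential (Z i)) <=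
  reg_energy + 2 * V.
Proof.
have := charge_energy_ge0 e_gt0 e_lt1 chargeL; rewrite L_energy.
by have := avg_reg_potential_le; lra.
Qed.

Lemma reg_deviation_le z : `|reg_deviation z| <=
  2 * Num.sqrt (- ln e *
    (reg_energy + 2 * V - 2 * (n%:R^-1 * \sum_i reg_potential (Z i)))) +
  e * rho ^+ 2.
Proof.
have le0 : 0 <= - ln e by rewrite oppr_ge0 ln_le0 // ltW.
have pot u : `|L (kap e u)| <= Num.sqrt (- ln e *
    (reg_energy + 2 * V - 2 * (n%:R^-1 * \sum_i reg_potential (Z i)))).
  rewrite -sqrtr_sqr ler_wsqrtr //.
  apply: le_trans (charge_potential_le e_gt0 e_lt1 u chargeL) _.
  by rewrite ler_wpM2l // L_energy; have := avg_reg_potential_le; lra.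
have := pot (Some z); have := pot None; have := L_infty; rewrite L_point.
move: (Num.sqrt _) (reg_deviation z) (L (kap e None)) (log_phi_mean - A) => S D l c.
by rewrite !ler_norml; lra.
Qed.

End Points.

End EquilibriumEnergy.

Section DiscreteEnergy.
Variables (R : realType) (n : nat) (Z : 'I_n -> Cplx R) (e : R).
Hypotheses (n_ge2 : (2 <= n)%N) (e_gt0 : 0 < e) (e_lt1 : e < 1).

Lemma sum_symmetric (f : 'I_n -> 'I_n -> R) : (forall i j, f i j = f j i) ->
  \sum_i \sum_j f i j =
  \sum_i f i i + 2 * \sum_(i < n) \sum_(j < n | (i < j)%N) f i j.
Proof.
move=> fC.
have split_row (i : 'I_n) : \sum_j f i j =
    f i i + (\sum_(j < n | (i < j)%N) f i j + \sum_(j < n | (j < i)%N) f i j).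
  rewrite (bigD1 i) //=; congr (_ + _).
  rewrite (bigID (fun j : 'I_n => (i < j)%N)) /=; congr (_ + _); apply: eq_bigl => j.
    by rewrite -(inj_eq val_inj) /= neq_ltn; case: ltngtP.
  by rewrite -(inj_eq val_inj) /= neq_ltn; case: ltngtP.
rewrite (eq_bigr _ (fun i _ => split_row i)) !big_split /=; congr (_ + _).
rewrite mulr_natl mulr2n; congr (_ + _).
rewrite (exchange_big_dep xpredT) //=.
by apply: eq_bigr => i _; apply: eq_bigr => j _.
Qed.

Lemma discrete_energyP :
  discrete_energy Z = +oo%E \/ exists2 I : R, discrete_energy Z = I%:E &
    n%:R ^+ 2 * reg_energy e Z <= 2 * (n%:R * (n%:R - 1) * I) + n%:R * - ln e.
Proof.
have n0 : (0 : R) < n%:R by rewrite ltr0n (leq_trans _ n_ge2).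
have n1 : (0 : R) < n%:R - 1 by rewrite subr_gt0 ltr1n.
have c0 : (0 : R) < 2 / (n%:R * (n%:R - 1)) by rewrite divr_gt0 ?mulr_gt0.
have [Z0|/existsNP[j /existsNP[k /not_implyP[jk /negP Zjk]]]] := pselect
    (forall j k : 'I_n, (j < k)%N -> 0 < modulus (Z j - Z k)); last first.
  left; have Zjk0 : modulus (Z j - Z k) = 0.
    by apply/eqP; rewrite eq_le modulus_ge0 andbT leNgt.
  have Ny i i' : log_kernel (Z i) (Z i') != -oo%E.
    have [m0|m0] := eqVneq (modulus (Z i - Z i')) 0.
      by rewrite log_kernel_pinfty.
    by rewrite log_kernelE // lt_def m0 modulus_ge0.
  rewrite /discrete_energy.
  suff -> : (\sum_(j < n) \sum_(k < n | (j < k)%N) log_kernel (Z j) (Z k) = +oo)%E.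
    by rewrite gt0_muley // lte_fin.
  apply/esum_eqyP.
    move=> i _; apply/negP => /eqP/esum_eqNyP[i' [_ _ h]].
    by have := Ny i i'; rewrite h.
  exists j; split; rewrite ?mem_index_enum //.
  apply/esum_eqyP; first by move=> i _; exact: Ny.
  by exists k; split; rewrite ?mem_index_enum ?log_kernel_pinfty.
right; exists (2 / (n%:R * (n%:R - 1)) * \sum_(j < n) \sum_(k < n | (j < k)%N)
    (- 2^-1 * ln (modulus (Z j - Z k) ^+ 2))).
  rewrite /discrete_energy [RHS]EFinM; congr (_ * _)%E; rewrite -sumEFin.
  apply: eq_bigr => j _; rewrite -sumEFin; apply: eq_bigr => k jk.
  by rewrite log_kernelE // Z0.
set S := \sum_(j < n) _.
have -> : n%:R ^+ 2 * reg_energy e Z = \sum_i \sum_j - ln (reg e (Z i) (Z j)).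
  by rewrite /reg_energy; field; rewrite gt_eqF.
have -> : n%:R * (n%:R - 1) * (2 / (n%:R * (n%:R - 1)) * S) = 2 * S.
  by field; rewrite !gt_eqF.
rewrite sum_symmetric; last by move=> i j; rewrite /reg modulusC [phi _ * _]mulrC.
rewrite addrC; apply: lerD.
  rewrite ler_pM2l // /S mulr_sumr; apply: ler_sum => i _.
  rewrite mulr_sumr; apply: ler_sum => j ij.
  rewrite mulrA mulrN mulfV ?pnatr_eq0 // mulN1r lerN2.
  by rewrite ler_ln ?posrE ?exprn_gt0 ?Z0 ?reg_gt0 ?reg_ge.
apply: (@le_trans _ _ (\sum_(i < n) - ln e)).
  by apply: ler_sum => i _; rewrite lerN2 ler_ln ?posrE ?reg_gt0 ?reg_diag.
by rewrite sumr_const card_ord -[_ *+ n]mulr_natl.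
Qed.

End DiscreteEnergy.

Lemma ln_prod (R : realType) (I : finType) (f : I -> R) :
  (forall i, 0 < f i) -> ln (\prod_i f i) = \sum_i ln (f i).
Proof.
move=> f0; have [] // : 0 < \prod_i f i /\ ln (\prod_i f i) = \sum_i ln (f i).
elim/big_rec2: _ => [|i x y _ [y0 yx]]; first by rewrite ln1.
by rewrite mulr_gt0 // lnM ?posrE // yx.
Qed.

Section Comparison.
Variables (R : realType) (E : set (Cplx R)) (mu : probability (BorelC R) R).
Variables (rho V CE s : R).
Hypotheses (cE : compact E) (equil : equilibrium_measure E mu).
Hypotheses (rho_ge1 : 1 <= rho) (E_rho : forall t, E t -> modulus t <= rho).
Hypotheses (robinE : robin E = V%:E) (CE_gt0 : 0 < CE) (s_gt0 : 0 < s).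
Hypothesis (holder : holder_green E mu CE s).
Variables (d : R).
Hypothesis (d_gt0 : 0 < d).

Let muE : supported_on E mu. Proof. by case: equil. Qed.

Let M := 1 + rho ^+ 2.
Let e := (d / M) ^+ 2.

Let M_ge1 : 1 <= M. Proof. by rewrite lerDl sqr_ge0. Qed.
Let M_gt0 : 0 < M. Proof. exact: lt_le_trans M_ge1. Qed.

Hypothesis (e_lt1 : e < 1).

Let e_gt0 : 0 < e. Proof. by rewrite exprn_gt0 // divr_gt0. Qed.

Lemma reg_potential_ge r z : d < r -> E z ->
  2 * V - (2 * (CE * (2 * r) `^ s) + d ^+ 2 / r ^+ 2) <= reg_potential E mu e z.
Proof.
move=> dr Ez.
have := smooth_avg_le cE muE rho_ge1 E_rho robinE CE_gt0 s_gt0 holder d_gt0 dr Ez.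
suff : - smooth_avg E mu d z <= reg_potential E mu e z by lra.
have asm := admissible_smooth rho_ge1 E_rho z d_gt0.
rewrite -(avgN cE muE) //; apply: (avg_le cE muE).
- exact: admissibleN.
- exact: (admissible_reg rho_ge1 E_rho).
- move=> t Et; rewrite lerN2 ler_ln ?posrE ?reg_gt0 //; last first.
    by rewrite ltr_wpDl ?sqr_ge0 ?exprn_gt0.
  have pp : phi z * phi t <= M * M.
    by apply: ler_pM; rewrite ?(phi_le_rho rho_ge1 E_rho) // ltW ?phi_gt0.
  have -> : d ^+ 2 = e * (M * M) by rewrite /e; field; rewrite gt_eqF.
  rewrite /reg lerD ?ler_wpM2l ?(ltW e_gt0) //.
  by rewrite ler_piMl ?sqr_ge0 // gerBl ltW.
Qed.

Lemma ln_reg_far (a : R) z t : 0 < a -> E t -> a <= modulus (z - t) ->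
  0 <= ln (reg e z t) - ln (modulus (z - t) ^+ 2) <= 2 * d ^+ 2 + 2 * (d / a) ^+ 2.
Proof.
move=> a0 Et az; set m := modulus (z - t); have m0 : 0 < m by exact: lt_le_trans az.
have mm : 0 < m ^+ 2 by rewrite exprn_gt0.
have reg0 := reg_gt0 e_gt0 e_lt1 z t.
rewrite subr_ge0 ler_ln ?posrE // (reg_ge e_gt0) /=.
rewrite -ln_div ?posrE //.
have -> : reg e z t / m ^+ 2 = 1 + (reg e z t / m ^+ 2 - 1) by ring.
apply: le_trans (le_ln1Dx _) _.
  by have := divr_gt0 reg0 mm; lra.
rewrite lerBlDr ler_pdivrMr //.
have pz : phi z <= 2 * m ^+ 2 + 2 * M.
  have : modulus z ^+ 2 <= (m + rho) ^+ 2.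
    rewrite ler_sqr ?nnegrE ?modulus_ge0 //; last by have := rho_ge1; lra.
    have := modulus_tri t z 0; rewrite !subr0 -/m.
    by have := E_rho Et; lra.
  have := sqr_ge0 (m - rho); rewrite /phi /M; lra.
have pt : phi t <= M by exact: (phi_le_rho rho_ge1 E_rho Et).
have pp : e * (phi z * phi t) <= e * ((2 * m ^+ 2 + 2 * M) * M).
  by rewrite ler_pM2l //; apply: ler_pM => //; exact/ltW/phi_gt0.
have eM2 : e * (M * M) = d ^+ 2 by rewrite /e; field; rewrite gt_eqF.
have eM : e * M <= d ^+ 2 by rewrite -eM2 ler_pM2l // ler_peMl // ltW.
have ma : d ^+ 2 <= (d / a) ^+ 2 * m ^+ 2.
  have da : 0 <= d / a * m by rewrite mulr_ge0 ?divr_ge0 // ltW.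
  rewrite -exprMn ler_sqr ?nnegrE ?(ltW d_gt0) //.
  by rewrite -mulrA ler_peMr ?(ltW d_gt0) // mulrC ler_pdivlMr // mul1r.
have em : e * M * m ^+ 2 <= d ^+ 2 * m ^+ 2 by rewrite ler_pM2r.
have e0 : 0 <= e * m ^+ 2 by rewrite mulr_ge0 // ltW.
have ppE : e * ((2 * m ^+ 2 + 2 * M) * M) = 2 * (e * M * m ^+ 2) + 2 * d ^+ 2.
  by rewrite -eM2; ring.
move: pp ma em e0; rewrite ppE /reg -/m mulrBl mul1r !mulrDl mul1r -!mulrA.
move: (e * (phi z * phi t)) (e * (M * m ^+ 2)) (e * m ^+ 2) => *; lra.
Qed.

Section Points.
Variables (n : nat) (Z : 'I_n -> Cplx R).
Hypotheses (n_gt0 : (0 < n)%N) (EZ : forall k, E (Z k)).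

Let n0 : (0 : R) < n%:R. Proof. by rewrite ltr0n. Qed.

Lemma modulus_nodal_poly z :
  modulus (nodal_poly Z).[z] = \prod_k modulus (z - Z k).
Proof.
rewrite /nodal_poly horner_prod modulus_prod; apply: eq_bigr => k _.
by rewrite hornerXsubC.
Qed.

Lemma log_deviation_le (a : R) z : 0 < a -> (forall t, E t -> a <= modulus (z - t)) ->
  (`|log_deviation E mu Z (Some z)| <=
   (`|reg_deviation E mu e Z z| + (2 * d ^+ 2 + 2 * (d / a) ^+ 2))%:E)%E.
Proof.
move=> a0 az; have zZ k : 0 < modulus (z - Z k) by exact: lt_le_trans (az _ (EZ k)).
have af := admissible_far rho_ge1 E_rho a0 az.
rewrite /log_deviation /green robinE (potential_far cE muE rho_ge1 E_rho a0 az).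
rewrite modulus_nodal_poly lne_EFin ?prodr_gt0 // ln_prod //.
rewrite -EFinM -EFinB abse_EFin lee_fin.
set kp := 2 * d ^+ 2 + _.
have S1 : \sum_k ln (modulus (z - Z k)) = 2^-1 * \sum_k ln (modulus (z - Z k) ^+ 2).
  by rewrite mulr_sumr; apply: eq_bigr => k _; rewrite lnXn //; field.
set S2 := \sum_k ln (modulus (z - Z k) ^+ 2) in S1.
set A2 := avg E mu _.
have bnd t : E t -> 0 <= ln (reg e z t) - ln (modulus (z - t) ^+ 2) <= kp.
  by move=> Et; apply: ln_reg_far => //; exact: az.
pose Sr := \sum_k ln (reg e z (Z k)).
have hS : 0 <= n%:R^-1 * (Sr - S2) <= kp.
  rewrite -sumrB mulr_ge0 ?invr_ge0 ?sumr_ge0 //=; last first.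
    by move=> k _; have /andP[] := bnd _ (EZ k).
  rewrite mulrC ler_pdivrMr //; apply: (@le_trans _ _ (\sum_(k < n) kp)).
    by apply: ler_sum => k _; have /andP[] := bnd _ (EZ k).
  by rewrite sumr_const card_ord mulr_natr.
have ar := admissible_reg rho_ge1 E_rho e_gt0 e_lt1 z.
have hA : 0 <= - reg_potential E mu e z - A2 <= kp.
  have -> : - reg_potential E mu e z - A2 =
      avg E mu (fun t => - (- ln (reg e z t)) + - ln (modulus (z - t) ^+ 2)).
    rewrite (avgD cE muE); [|exact: admissibleN|exact: admissibleN].
    by rewrite (avgN cE muE ar) (avgN cE muE af).
  have aD := admissibleD (admissibleN ar) (admissibleN af).
  rewrite -(avg_cst cE muE 0) -(avg_cst cE muE kp).
  by apply/andP; split; apply: (avg_le cE muE) => //; try exact: admissible_cst;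
    move=> t /bnd; rewrite opprK => /andP[].
have hD : reg_deviation E mu e Z z = reg_potential E mu e z + n%:R^-1 * Sr.
  by rewrite /reg_deviation /Sr sumrN mulrN opprK.
move: hS hA (ler_norm (reg_deviation E mu e Z z)) (ler_norm (- reg_deviation E mu e Z z)).
rewrite normrN hD S1 mulrBr => /andP[h1 h2] /andP[h3 h4] h5 h6.
have h7 : n%:R^-1 * (2^-1 * S2) = 2^-1 * (n%:R^-1 * S2) by ring.
rewrite h7 ler_norml; apply/andP; split; lra.
Qed.

Lemma sup_norm_le (D b : R) : (forall z, E z -> `|reg_deviation E mu e Z z| <= D) ->
  (forall z, E z -> 2 * V - b <= reg_potential E mu e z) ->
  (lne (sup_norm E (nodal_poly Z))%:E + n%:R%:E * robin E <=
   (2^-1 * (n%:R * (D + b)))%:E)%E.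
Proof.
move=> DE bE; set B := 2^-1 * _.
have PE z : E z -> modulus (nodal_poly Z).[z] <= expR (B - n%:R * V).
  move=> Ez; rewrite modulus_nodal_poly.
  rewrite -ler_sqr ?nnegrE ?prodr_ge0 ?expR_ge0 //; last first.
    by move=> k _; exact: modulus_ge0.
  rewrite -prodrXl; apply: (@le_trans _ _ (\prod_k reg e z (Z k))).
    by apply: ler_prod => k _; rewrite sqr_ge0 reg_ge.
  have rz k : 0 < reg e z (Z k) by exact: reg_gt0.
  rewrite -[leLHS]lnK ?posrE ?prodr_gt0 // -expRM_natl ler_expR ln_prod //.
  have : `|reg_deviation E mu e Z z| <= D by exact: DE.
  rewrite /reg_deviation sumrN mulrN opprK ler_norml => /andP[_].
  have := bE z Ez => h1 h2.
  have : n%:R^-1 * \sum_k ln (reg e z (Z k)) <= D + b - 2 * V by lra.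
  rewrite mulrC ler_pdivrMr // => h3.
  by rewrite /B; lra.
have [t Et] := support_nonempty cE muE.
have supE : sup_norm E (nodal_poly Z) <= expR (B - n%:R * V).
  apply: ge_sup; first by exists (modulus (nodal_poly Z).[t]); exists t.
  by move=> _ [z Ez <-]; exact: PE.
have lneE : (lne (sup_norm E (nodal_poly Z))%:E <= (B - n%:R * V)%:E)%E.
  have [s0|s0] := leP (sup_norm E (nodal_poly Z)) 0; first by rewrite le0_lneNy ?leNye.
  rewrite lne_EFin // lee_fin -[leRHS]expRK ler_ln ?posrE ?expR_gt0 //.
rewrite robinE -EFinM; apply: le_trans (leeD2r _ lneE) _.
by rewrite -EFinD lee_fin subrK.
Qed.

End Points.

End Comparison.

(** * The estimates at scale [n^(-1/s)] *)

Section Scale.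
Variables (R : realType) (s : R) (n : nat).
Hypotheses (s_gt0 : 0 < s) (n_ge2 : (2 <= n)%N).

Definition scale : R := n%:R `^ (- s^-1).

Let N_gt0 : (0 : R) < n%:R. Proof. by rewrite ltr0n (leq_trans _ n_ge2). Qed.

Lemma scale_gt0 : 0 < scale.
Proof. exact: powR_gt0. Qed.

Lemma scale_le1 : scale <= 1.
Proof.
rewrite -(powRr0 n%:R) ler_powR ?oppr_le0 ?invr_ge0 ?(ltW s_gt0) //.
by rewrite ler1n (leq_trans _ n_ge2).
Qed.

Lemma scaleX : scale `^ s = n%:R^-1.
Proof. by rewrite /scale -powRrM mulNr mulVf ?gt_eqF // powR_inv1 // ltW. Qed.

Lemma scale2X : s <= 1 -> (2 * scale) `^ s <= 2 / n%:R.
Proof.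
move=> s1; rewrite powRM ?(ltW scale_gt0) // scaleX ler_pM2r ?invr_gt0 //.
by rewrite -{2}[2]powRr1 // ler_powR // ler1n.
Qed.

Lemma ln_scale : ln scale = - s^-1 * ln n%:R.
Proof. by rewrite ln_powR. Qed.

End Scale.

Lemma closure_Omega_n_far (R : realType) (E : set (Cplx R))
    (mu : probability (BorelC R) R) (CE s : R) (n : nat) (z : Cplx R) :
  compact E -> supported_on E mu -> 0 < CE -> 0 < s -> holder_green E mu CE s ->
  (2 <= n)%N -> closure (Omega_n E mu n) (Some z) ->
  forall t, E t -> scale s n / (2 * CE `^ s^-1) <= modulus (z - t).
Proof.
move=> cE muE CE_gt0 s_gt0 holder n2; set k := CE `^ s^-1; set r := scale s n.
have k_gt0 : 0 < k by exact: powR_gt0.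
have r_gt0 : 0 < r := scale_gt0 s n2.
set a := r / (2 * k); have a_gt0 : 0 < a by rewrite divr_gt0 // mulr_gt0.
move=> /(closure_Some a_gt0)[w [Ow gw] zw].
have wd : 2 * a < dist E w.
  have := lt_le_trans gw (holder w Ow); rewrite lte_fin => h.
  rewrite ltNge; apply/negP => wa.
  have : dist E w `^ s <= (2 * a) `^ s.
    rewrite ge0_ler_powR ?nnegrE ?(ltW s_gt0) ?(dist_ge0 cE muE) //.
    by rewrite mulr_ge0 // ltW.
  have -> : 2 * a = r / k by rewrite /a; field; rewrite gt_eqF.
  have ks : k `^ s = CE by rewrite /k -powRrM mulVf ?gt_eqF // powRr1 // ltW.
  have -> : (r / k) `^ s = n%:R^-1 / CE.
    rewrite powRM ?invr_ge0 ?(ltW k_gt0) ?(ltW r_gt0) // scaleX //; congr (_ * _).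
    by rewrite -powR_inv1 ?(ltW k_gt0) // -powRrM mulrC powRrM ks powR_inv1 // ltW.
  by rewrite ler_pdivlMr // mulrC leNgt h.
move=> t Et; have := dist_le w Et; have := modulus_tri z w t.
by rewrite (modulusC w z); lra.
Qed.

Theorem theorem2p2 (R : realType) (E : set (Cplx R))
    (mu : probability (BorelC R) R) (CE s C1 : R)
    (cptE : compact E) (capE : (0 < capacity E)%E)
    (equil : equilibrium_measure E mu)
    (CE_gt0 : 0 < CE) (s_gt0 : 0 < s) (s_le1 : s <= 1)
    (holder : holder_green E mu CE s)
    (C1_gt0 : 0 < C1) :
  exists C2 C3 : R, 0 < C2 /\ 0 < C3 /\
    forall Z : forall n : nat, 'I_n -> Cplx R,
      (forall n, (2 <= n)%N -> forall k : 'I_n, E (Z n k)) ->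
      (forall n, (2 <= n)%N ->
         (discrete_energy (Z n) - robin E <= (C1 * (ln n%:R / n%:R))%:E)%E) ->
      forall n, (2 <= n)%N ->
        [/\ forall x : Sphere R, closure (Omega_n E mu n) x ->
              (`|log_deviation E mu (Z n) x|
                 <= (C2 * (ln n%:R / Num.sqrt n%:R))%:E)%E,
            (lne (sup_norm E (nodal_poly (Z n)))%:E + n%:R%:E * robin E
               <= (C2 * (Num.sqrt n%:R * ln n%:R) + 1)%:E)%E
          & ((- (C3 * (ln n%:R / Num.sqrt n%:R)))%:E
               <= discrete_energy (Z n) - robin E)%E].
Proof.
have [rho rho_ge1 E_rho] := compact_modulus_bounded cptE.
have /fineK := robin_fin_num cptE equil rho_ge1 E_rho capE.
set V := fine _ => /esym robinE; clearbody V.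
have muE : supported_on E mu by case: equil.
set M := 1 + rho ^+ 2.
have M_ge1 : 1 <= M by rewrite lerDl sqr_ge0.
have M_gt0 : 0 < M by exact: lt_le_trans M_ge1.
have lnM_ge0 : 0 <= ln M by exact: ln_ge0.
have s1_gt0 : 0 < s^-1 by rewrite invr_gt0.
pose lam : R := ln 2.
have lam_gt0 : 0 < lam by rewrite ln_gt0 // ltr1n.
pose k := CE `^ s^-1.
have k_gt0 : 0 < k by exact: powR_gt0.
pose cL := 2 * ln M / lam + 2 * (s^-1 + 1).
have cL_gt0 : 0 < cL.
  by rewrite ltr_wpDl ?divr_ge0 ?mulr_ge0 ?(ltW lam_gt0) // mulr_gt0 // addr_gt0.
pose cq := (2 * `|V| + 8 * CE + 2) / lam + 2 * C1 + cL.
have cq_gt0 : 0 < cq.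
  rewrite addr_gt0 // addr_gt0 ?mulr_gt0 ?invr_gt0 //.
  by have := normr_ge0 V; lra.
pose cD := 2 * Num.sqrt (cL * cq) + lam^-1.
pose ck := (2 + 8 * k ^+ 2) / lam.
pose cb := (4 * CE + 1) / lam.
have cD_ge0 : 0 <= cD by rewrite addr_ge0 ?mulr_ge0 ?sqrtr_ge0 ?invr_ge0 ?(ltW lam_gt0).
have ck_gt0 : 0 < ck by rewrite divr_gt0 //; have := exprn_gt0 2 k_gt0; lra.
have cb_gt0 : 0 < cb by rewrite divr_gt0 //; lra.
exists (cD + ck + cb), cq; split; first by lra.
split=> // Z ZE ZV n n2.
have EZ := ZE n n2; have n_gt0 : (0 < n)%N by exact: leq_trans n2.
have N2 : (2 : R) <= n%:R by rewrite ler_nat.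
have N0 : (0 : R) < n%:R by lra.
have lamN : lam <= ln n%:R by rewrite ler_ln ?posrE //; lra.
pose q : R := Num.sqrt n%:R.
have qq : q ^+ 2 = n%:R by rewrite sqr_sqrtr // ltW.
have q_ge0 : 0 <= q by exact: sqrtr_ge0.
have q_ge1 : 1 <= q by rewrite -(sqrtr1 R) ler_wsqrtr //; lra.
have q_gt0 : 0 < q by lra.
have qN : q <= n%:R by rewrite -qq expr2 ler_peMr.
move: (ZV n n2); set l := ln n%:R in lamN * => Zn.
have l_gt0 : 0 < l by lra.
have scaleup c : 0 <= c -> c <= c / lam * l.
  by move=> c0; rewrite -mulrA ler_peMr // mulrC ler_pdivlMr // mul1r.
pose r := scale s n; have r_gt0 : 0 < r := scale_gt0 s n2.
have r_le1 : r <= 1 := scale_le1 s_gt0 n2.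
pose d := r / n%:R; have d_gt0 : 0 < d by rewrite divr_gt0.
have dr : d < r by rewrite ltr_pdivrMr // ltr_pMr //; lra.
have dN : d <= n%:R^-1 by rewrite ler_piMl ?invr_ge0 // ltW.
have N1 : n%:R^-1 <= (1 : R) by rewrite invf_le1 //; lra.
have dd : d ^+ 2 <= n%:R^-1.
  by rewrite expr2 -[leRHS]mulr1; apply: ler_pM => //; lra.
pose e := (d / M) ^+ 2.
have dM1 : d / M < 1 by rewrite ltr_pdivrMr // mul1r; lra.
have dM0 : 0 < d / M by rewrite divr_gt0.
have e_gt0 : 0 < e by rewrite exprn_gt0.
have e_lt1 : e < 1 by rewrite expr_lt1 // ltW.
have LeE : - ln e = 2 * ln M + 2 * (s^-1 + 1) * l.
  by rewrite /e lnXn // ln_div ?posrE // ln_div ?posrE // ln_scale // -/l; ring.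
have Lle : - ln e <= cL * l.
  have /scaleup : 0 <= 2 * ln M by lra.
  by rewrite LeE /cL; lra.
pose b := (4 * CE + 1) / n%:R.
have U_ge z : E z -> 2 * V - b <= reg_potential E mu e z.
  move=> Ez.
  have := reg_potential_ge cptE equil rho_ge1 E_rho robinE CE_gt0 s_gt0 holder d_gt0 e_lt1 dr Ez.
  suff : 2 * (CE * (2 * r) `^ s) + d ^+ 2 / r ^+ 2 <= b by rewrite -/M -/e; lra.
  have h1 : CE * (2 * r) `^ s <= CE * (2 / n%:R) by rewrite ler_pM2l // scale2X.
  have h2 : d ^+ 2 / r ^+ 2 <= n%:R^-1.
    have -> : d ^+ 2 / r ^+ 2 = n%:R^-1 * n%:R^-1.
      by rewrite /d; field; rewrite !gt_eqF.
    by rewrite ler_piMr // invr_ge0 ltW.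
  by rewrite /b; lra.
set T := reg_energy e (Z n).
pose X := n%:R^-1 * \sum_i reg_potential E mu e (Z n i).
have X_ge : 2 * V - b <= X.
  rewrite /X [_^-1 * _]mulrC ler_pdivlMr //.
  have -> : (2 * V - b) * n%:R = \sum_(i < n) (2 * V - b) by rewrite sumr_const card_ord mulr_natr.
  by apply: ler_sum => i _; exact: U_ge.
have TX : 2 * X <= T + 2 * V by exact: (reg_energy_ge cptE equil rho_ge1 E_rho).
have Nb : n%:R * b = 4 * CE + 1 by rewrite /b mulrC divfK // gt_eqF.
have V_abs : - V <= `|V| by rewrite -normrN ler_norm.
have cqE : cq * l = (2 * `|V| + 8 * CE + 2) / lam * l + 2 * C1 * l + cL * l.
  by rewrite /cq !mulrDl.
have Vup : 2 * `|V| + 8 * CE + 2 <= (2 * `|V| + 8 * CE + 2) / lam * l.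
  by apply: scaleup; have := normr_ge0 V; lra.
have lqN : l / n%:R <= l / q by rewrite ler_pM2l // lef_pV2 ?posrE.
have part3 : ((- (cq * (l / q)))%:E <= discrete_energy (Z n) - robin E)%E.
  rewrite robinE; case: (discrete_energyP (Z n) n2 e_gt0 e_lt1) => [->|[I -> TI]].
    by rewrite addye // leey.
  rewrite -EFinB lee_fin.
  have NT : n%:R * T <= 2 * (n%:R - 1) * I + - ln e.
    by rewrite -(ler_pM2l N0); move: TI; rewrite -/T; lra.
  have NT2 : 2 * (n%:R * V) - 2 * (4 * CE + 1) <= n%:R * T.
    have -> : 2 * (n%:R * V) - 2 * (4 * CE + 1) = n%:R * (2 * V - 2 * b) by rewrite -Nb; ring.
    by rewrite ler_pM2l //; lra.
  have h1 : - (cq * l) <= 2 * (n%:R - 1) * (I - V).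
    have C1l : 0 <= C1 * l by rewrite mulr_ge0 // ltW.
    by rewrite cqE; lra.
  have h2 : cq * l <= 2 * (n%:R - 1) * (cq * (l / n%:R)).
    have -> : cq * l = n%:R * (cq * (l / n%:R)) by field; rewrite gt_eqF.
    by rewrite ler_pM2r ?mulr_gt0 ?invr_gt0 //; lra.
  have N11 : 0 < 2 * (n%:R - 1) :> R by lra.
  have h3 : - (cq * (l / n%:R)) <= I - V by rewrite -(ler_pM2l N11) mulrN; lra.
  have : cq * (l / n%:R) <= cq * (l / q) by rewrite ler_pM2l.
  by rewrite -/q; lra.
have [I IE TI] : exists2 I : R, discrete_energy (Z n) = I%:E &
    n%:R ^+ 2 * T <= 2 * (n%:R * (n%:R - 1) * I) + n%:R * - ln e.
  case: (discrete_energyP (Z n) n2 e_gt0 e_lt1) => // ZnE.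
  by move: Zn; rewrite ZnE robinE addye.
have IV : I <= V + C1 * (l / n%:R).
  by move: Zn; rewrite IE robinE -EFinB lee_fin; lra.
have Q_le : T + 2 * V - 2 * X <= cq * l / n%:R.
  have NT : n%:R * T <= 2 * (n%:R - 1) * I + - ln e.
    by rewrite -(ler_pM2l N0); move: TI; lra.
  have N11 : 0 < 2 * (n%:R - 1) :> R by lra.
  have h1 : 2 * (n%:R - 1) * I <= 2 * (n%:R - 1) * (V + C1 * (l / n%:R)) by rewrite ler_pM2l.
  have h2 : (n%:R - 1) * (C1 * (l / n%:R)) <= C1 * l.
    have -> : C1 * l = n%:R * (C1 * (l / n%:R)) by field; rewrite gt_eqF.
    by rewrite ler_pM2r ?mulr_gt0 ?invr_gt0 //; lra.
  apply: (@le_trans _ _ (T - 2 * V + 2 * b)); first by lra.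
  rewrite ler_pdivlMr // cqE.
  have -> : (T - 2 * V + 2 * b) * n%:R = n%:R * T - 2 * n%:R * V + 2 * (4 * CE + 1).
    by rewrite -Nb; ring.
  by lra.
have D_le z : `|reg_deviation E mu e (Z n) z| <= cD * (l / q).
  apply: le_trans (reg_deviation_le cptE equil rho_ge1 E_rho robinE e_gt0 e_lt1 n_gt0 EZ z) _.
  rewrite -/T -/X /cD [(_ + lam^-1) * _]mulrDl; apply: lerD.
    rewrite -mulrA ler_pM2l //; apply: (@le_trans _ _ (Num.sqrt (cL * cq * (l / q) ^+ 2))).
      apply: ler_wsqrtr.
      have -> : cL * cq * (l / q) ^+ 2 = cL * l * (cq * l / n%:R).
        by rewrite -qq; field; rewrite gt_eqF.
      by apply: ler_pM => //; [rewrite oppr_ge0 ln_le0 // ltW|lra].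
    rewrite sqrtrM ?mulr_ge0 ?(ltW cL_gt0) ?(ltW cq_gt0) // sqrtr_sqr.
    by rewrite ger0_norm // divr_ge0 // ltW.
  apply: (@le_trans _ _ (d ^+ 2)).
    have -> : d ^+ 2 = e * (M * M) by rewrite /e; field; rewrite gt_eqF.
    rewrite ler_pM2l //; apply: (@le_trans _ _ M); first by rewrite lerDr.
    by rewrite ler_peMl // ltW.
  apply: le_trans dd _; rewrite mulrA; apply: (@le_trans _ _ q^-1).
    by rewrite lef_pV2.
  by rewrite ler_peMl ?invr_ge0 // mulrC ler_pdivlMr // mul1r.
have part1 (x : Sphere R) : closure (Omega_n E mu n) x ->
    (`|log_deviation E mu (Z n) x| <= ((cD + ck + cb) * (l / q))%:E)%E.
  have lq0 : 0 < l / q by rewrite divr_gt0.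
  case: x => [z|_]; last first.
    rewrite /log_deviation abse0 lee_fin mulr_ge0 ?(ltW lq0) //.
    by lra.
  pose a := r / (2 * k); have a_gt0 : 0 < a by rewrite divr_gt0 // mulr_gt0.
  move=> /(closure_Omega_n_far cptE muE CE_gt0 s_gt0 holder n2); rewrite -/r -/k -/a => az.
  apply: le_trans (log_deviation_le cptE equil rho_ge1 E_rho robinE d_gt0 e_lt1
    n_gt0 EZ a_gt0 az) _.
  rewrite lee_fin -(addrA cD) [(cD + _) * _]mulrDl; apply: lerD; first exact: D_le.
  have -> : d / a = 2 * k / n%:R by rewrite /d /a; field; rewrite !gt_eqF.
  have NN : n%:R^-1 ^+ 2 <= n%:R^-1 :> R by rewrite expr2 ler_piMl ?invr_ge0 // ltW.
  have Nq : n%:R^-1 <= q^-1 by rewrite lef_pV2.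
  have kk : (2 * k / n%:R) ^+ 2 <= 4 * k ^+ 2 * n%:R^-1.
    have -> : (2 * k / n%:R) ^+ 2 = 4 * k ^+ 2 * n%:R^-1 ^+ 2 by ring.
    by rewrite ler_pM2l // mulr_gt0 // exprn_gt0.
  apply: (@le_trans _ _ ((2 + 8 * k ^+ 2) * n%:R^-1)); first by lra.
  have k2 : 0 <= 2 + 8 * k ^+ 2 by have := exprn_gt0 2 k_gt0; lra.
  apply: (@le_trans _ _ ((2 + 8 * k ^+ 2) * q^-1)); first by rewrite ler_wpM2l.
  have := ler_wpM2r (_ : 0 <= q^-1) (scaleup _ k2); rewrite -/ck invr_ge0 => /(_ q_ge0) h.
  by have := mulr_gt0 cb_gt0 lq0; lra.
split; [exact: part1| |exact: part3].
have := sup_norm_le cptE equil robinE d_gt0 e_lt1 n_gt0 (fun z _ => D_le z) U_ge.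
move=> /le_trans; apply.
rewrite lee_fin mulrDr Nb.
have -> : n%:R * (cD * (l / q)) = cD * (q * l).
  by rewrite -qq; field; rewrite gt_eqF.
have ql : l <= q * l by rewrite ler_peMl // ltW.
have cbl : 4 * CE + 1 <= cb * (q * l).
  apply: (@le_trans _ _ (cb * l)); first by apply: scaleup; lra.
  by rewrite ler_pM2l.
have ql0 : 0 <= q * l by rewrite mulr_ge0 // ltW.
have ckl : 0 <= ck * (q * l) := mulr_ge0 (ltW ck_gt0) ql0.
have cDl : 0 <= cD * (q * l) := mulr_ge0 cD_ge0 ql0.
by rewrite -/q; lra.
Qed.
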